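(* Let $q,q'$ be integers with $\max(0,q-1)\le q'\le q$ and $q+q'\ge 1$. There exists a unique operator of the form $$[\mathcal{D}_{xx}^c w]_j=\frac{1}{h^2}\sum_{k=-q}^{q-1}a_k\,\overline{w}_{j+k+1/2}+\frac{1}{h^2}\sum_{k=-q'}^{q'}b_k\,w_{j+k}$$ (with constants $a_k,b_k$ independent of $w$ and $h$) which is at least $2(q+q')$-th order accurate. Its coefficients are $$a_\nu=a_{-1-\nu}\quad(-q\le\nu<0),$$ $$a_\nu=\sum_{k=\nu+1}^{q'}\frac{6\left(2+k(\zeta_k^{q,q}+\zeta_k^{q',q'})\right)}{k^3}C_k^{q,q}C_k^{q',q'}+(1-\delta_{qq'})\frac{6}{q^3}C_q^{q,q}C_q^{q',q}\quad(0\le\nu\le q-1),$$ $$b_0=-\sum_{-q\le k\le q,\,k\ne0}\frac{3}{k^2}-\sum_{-q'\le k\le q',\,k\ne0}\frac{3}{k^2},$$ $$b_\nu=-\frac{6}{\nu^2}C_\nu^{q,q}C_\nu^{q',q'}\quad(-q'\le\nu\le q',\ \nu\ne0).$$ Furthermore, for this operator, $\sum_{k=-q'}^{q'}b_k<0$.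
   Context: The grid is uniform with cell size $h>0$ and nodes $x_j=jh$. The operator acts on nodal values $w_j$ and cell averages $\overline{w}_{j+1/2}$. When evaluated on a smooth function $w(x)$, one uses the exact values $w_j^\star=w(x_j)$ and $\overline{w}^\star_{j+1/2}=\frac1h\int_{x_j}^{x_{j+1}}w(x)\,dx$; the result is denoted $[\mathcal{D}_{xx}^cw^\star]_j$. Order of accuracy: $[\mathcal{D}_{xx}^c]$ is $P$-th order accurate ($P\ge1$ an integer) if for every $C^\infty$ function $w$, $[\mathcal{D}_{xx}^cw^\star]_j=w''(x_j)+C\,w^{(P+2)}(x_j)h^P+O(h^{P+2})$ with a nonzero constant $C$ independent of $w$ and $h$. ''At least $m$-th order accurate'' means $P$-th order accurate for some $P\ge m$; in particular $[\mathcal{D}_{xx}^cw^\star]_j=w''(x_j)$ for every polynomial $w$ of degree at most $m+1$. Constants: for integers $l,r\ge0$ and $-l\le\nu\le r$, $\zeta_\nu^{l,r}=\sum_{-l\le k\le r,\,k\ne\nu}\frac{1}{\nu-k}=H_{l+\nu}-H_{r-\nu}$ and $C_\nu^{l,r}=\frac{l!\,r!}{(l+\nu)!\,(r-\nu)!}$, where $H_n=1+\frac12+\cdots+\frac1n$, $H_0=0$. $\delta_{qq'}$ is the Kronecker delta. Empty sums are zero. *)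

(* Defs.v *)
From Stdlib Require Import Reals ZArith List.
From Coquelicot Require Import Coquelicot.
Open Scope R_scope.

(** Sum of [f k] over the integers [lo <= k <= hi]; it is [0] if [hi < lo]. *)
Definition sumZ (lo hi : Z) (f : Z -> R) : R :=
  fold_right Rplus 0
    (map (fun i : nat => f (lo + Z.of_nat i)%Z)
         (seq 0 (Z.to_nat (hi - lo + 1)))).

(** The same sum with the index [k = nu] left out. *)
Definition sumZ_except (lo hi nu : Z) (f : Z -> R) : R :=
  sumZ lo hi (fun k => if Z.eqb k nu then 0 else f k).

Definition kronecker (i j : Z) : R := if Z.eqb i j then 1 else 0.

(** The next two are meant for [0 <= l], [0 <= r] and [-l <= nu <= r]: outside
    this range [Z.to_nat] truncates negative arguments of the factorials. *)
Definition zeta (l r nu : Z) : R :=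
  sumZ_except (- l) r nu (fun k => 1 / IZR (nu - k)).

Definition Ccoef (l r nu : Z) : R :=
  INR (fact (Z.to_nat l)) * INR (fact (Z.to_nat r)) /
  (INR (fact (Z.to_nat (l + nu))) * INR (fact (Z.to_nat (r - nu)))).

Definition node (h : R) (j : Z) : R := IZR j * h.

(** Grid operators take the cell size [h], the cell averages, the nodal values
    and the node index [j].  The cell [x_i, x_{i+1}], of midpoint index
    [i + 1/2], is indexed by the integer [i]. *)
Definition grid_operator : Type := R -> (Z -> R) -> (Z -> R) -> Z -> R.

Definition Dxx (q q' : Z) (a b : Z -> R) : grid_operator :=
  fun h wbar w j =>
    1 / h ^ 2 * sumZ (- q) (q - 1) (fun k => a k * wbar (j + k)%Z) +
    1 / h ^ 2 * sumZ (- q') q' (fun k => b k * w (j + k)%Z).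

Definition exact_average (w : R -> R) (h : R) (i : Z) : R :=
  1 / h * RInt w (node h i) (node h (i + 1)).

Definition exact_nodal (w : R -> R) (h : R) (j : Z) : R := w (node h j).

Definition eval_exact (D : grid_operator) (w : R -> R) (h : R) (j : Z) : R :=
  D h (exact_average w h) (exact_nodal w h) j.

Definition smooth (w : R -> R) : Prop := forall n x, ex_derive_n w n x.

(** The [O(h^(P+2))] is for [h -> 0+] and uniform over the nodes [x_j] in any
    bounded interval [[A, B]]: since [x_j = j h] moves with [h], a bound for a
    single fixed [j] would only test [w] near [0]. *)
Definition order_accurate (D : grid_operator) (P : nat) : Prop :=
  (1 <= P)%nat /\
  exists C : R, C <> 0 /\
    forall w : R -> R, smooth w ->
    forall A B : R, exists K h0 : R, 0 < h0 /\
      forall (h : R) (j : Z), 0 < h < h0 -> A <= node h j <= B ->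
        Rabs (eval_exact D w h j
              - (Derive_n w 2 (node h j)
                 + C * Derive_n w (P + 2) (node h j) * h ^ P))
        <= K * h ^ (P + 2).

Definition at_least_order_accurate (D : grid_operator) (m : Z) : Prop :=
  exists P : nat, (m <= Z.of_nat P)%Z /\ order_accurate D P.

(* Main.v *)
(** Let [W] be an antiderivative of [w].  At [h = 1], [j = 0], an operator of the
    given form is the functional
    [sum_k a_k (W(k+1) - W(k)) + sum_k b_k W'(k)], i.e. a combination
    [sum_k c_k W(k) + sum_k b_k W'(k)] with [c_k = a_(k-1) - a_k], and accuracy
    of order at least [2(q+q')] forces it to equal [W'''(0)] on all polynomials
    [W] of degree less than [N = 2(q+q') + 2].  Since [N] is the number of Hermite
    data [W(k)] ([|k| <= q]), [W'(k)] ([|k| <= q']), the operator is unique, and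
    [c_k], [b_k] are the third derivatives at [0] of the Hermite cardinal
    polynomials.  These are read off from
    [Omega = prod_(|k| <= q) (x - k) prod_(|k| <= q') (x - k) = x^2 G], [G] even.
    The functional kills the multiples of [Omega], so it gives [-6 G(0) <> 0] on
    [x^(N+1)], while it vanishes on [x^N] and [x^(N+2)] by parity; Taylor's
    formula turns this into the exact order [2(q+q')]. *)

Require Import Defs.
From Stdlib Require Import Reals ZArith List Lra Lia.
From Coquelicot Require Import Coquelicot.
From mathcomp Require all_boot all_order all_algebra.
From mathcomp Require ring zify ssrZ Rstruct.
Open Scope R_scope.

(** * Moments and order of accuracy *)

Lemma sumZ_ext (lo hi : Z) (f g : Z -> R) :
  (forall k, (lo <= k <= hi)%Z -> f k = g k) -> sumZ lo hi f = sumZ lo hi g.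
Proof.
  intros H. unfold sumZ. f_equal. apply map_ext_in. intros i Hi.
  apply in_seq in Hi. apply H. lia.
Qed.

Lemma sumZ_plus (lo hi : Z) (f g : Z -> R) :
  sumZ lo hi (fun k => f k + g k) = sumZ lo hi f + sumZ lo hi g.
Proof.
  unfold sumZ. induction (seq 0 _) as [|i s IH]; simpl; [lra | rewrite IH; lra].
Qed.

Lemma sumZ_scal (lo hi : Z) (c : R) (f : Z -> R) :
  sumZ lo hi (fun k => c * f k) = c * sumZ lo hi f.
Proof.
  unfold sumZ. induction (seq 0 _) as [|i s IH]; simpl; [lra | rewrite IH; lra].
Qed.

Lemma sumZ_Rabs_le (lo hi : Z) (f g : Z -> R) :
  (forall k, (lo <= k <= hi)%Z -> Rabs (f k) <= g k) ->
  Rabs (sumZ lo hi f) <= sumZ lo hi g.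
Proof.
  intros H. unfold sumZ.
  assert (H' : forall i, In i (seq 0 (Z.to_nat (hi - lo + 1))) ->
     Rabs (f (lo + Z.of_nat i)%Z) <= g (lo + Z.of_nat i)%Z).
  { intros i Hi. apply in_seq in Hi. apply H. lia. }
  revert H'. induction (seq 0 _) as [|i s IH]; simpl; intros H'.
  - rewrite Rabs_R0. lra.
  - eapply Rle_trans; [apply Rabs_triang|]. apply Rplus_le_compat; auto.
Qed.

(** [Dxx q q' a b] applied to [x ^ d] with [h = 1], at the node [0]. *)
Definition moment (q q' : Z) (a b : Z -> R) (d : nat) : R :=
  sumZ (- q) (q - 1)
    (fun k => a k * ((IZR (k + 1) ^ S d - IZR k ^ S d) / INR (S d))) +
  sumZ (- q') q' (fun k => b k * IZR k ^ d).

Lemma smooth_continuous (w : R -> R) : smooth w -> forall x, continuous w x.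
Proof. intros H x. apply (ex_derive_continuous w x), (H 1%nat x). Qed.

(** The shape [f + c * g] serves both to add Taylor terms one at a time and, with [c = -1], to
    subtract a Taylor polynomial. *)
Lemma eval_exact_linear (q q' : Z) (a b : Z -> R) (f g : R -> R) (c h : R) (j : Z) :
  (forall x, continuous f x) -> (forall x, continuous g x) ->
  eval_exact (Dxx q q' a b) (fun t => f t + c * g t) h j =
  eval_exact (Dxx q q' a b) f h j + c * eval_exact (Dxx q q' a b) g h j.
Proof.
  intros Hf Hg. unfold eval_exact, Dxx.
  rewrite (sumZ_ext _ _ (fun k => a k * exact_average (fun t => f t + c * g t)
    h (j + k))
    (fun k => a k * exact_average f h (j + k)
              + c * (a k * exact_average g h (j + k)))).
  2:{ intros k _. unfold exact_average.
      rewrite (RInt_plus f (fun t => c * g t)), (RInt_scal g).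
      - change plus with Rplus; change scal with Rmult; simpl. lra.
      - apply ex_RInt_continuous; auto.
      - apply ex_RInt_continuous; auto.
      - apply ex_RInt_continuous. intros z _. apply (continuous_scal_r c g); auto. }
  rewrite (sumZ_ext _ _ (fun k => b k * exact_nodal (fun t => f t + c * g t) h (j + k))
    (fun k => b k * exact_nodal f h (j + k)
              + c * (b k * exact_nodal g h (j + k)))).
  2:{ intros k _. unfold exact_nodal. lra. }
  rewrite !sumZ_plus, !sumZ_scal. lra.
Qed.

Lemma RInt_shifted_pow (x lo hi : R) (d : nat) :
  RInt (fun t => (t - x) ^ d) lo hi =
  ((hi - x) ^ S d - (lo - x) ^ S d) / INR (S d).
Proof.
  assert (Hd : INR (S d) <> 0) by (apply not_0_INR; lia).
  replace (_ / _) with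
    (minus ((hi - x) ^ S d / INR (S d)) ((lo - x) ^ S d / INR (S d)))
    by (unfold minus, plus, opp; simpl; field; exact Hd).
  apply is_RInt_unique.
  apply (is_RInt_derive (fun t => (t - x) ^ S d / INR (S d))).
  - intros t _. auto_derive; trivial.
    (* The [match] is [INR (S d)] as unfolded by [auto_derive]. *)
    change (match d with 0%nat => 1 | S _ => INR d + 1 end) with (INR (S d)).
    unfold Rminus. field. exact Hd.
  - intros t _. apply (ex_derive_continuous (fun t => (t - x) ^ d)).
    auto_derive; trivial.
Qed.

(** The substitution [t = x_j + h s] carries the grid to the integers; each average or nodal value
    of the power scales by [h ^ d]. *)
Lemma eval_exact_shifted_pow (q q' : Z) (a b : Z -> R) (h : R) (j : Z) (d : nat) :
  h <> 0 ->
  eval_exact (Dxx q q' a b) (fun t => (t - node h j) ^ d) h j =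
  h ^ d * moment q q' a b d / h ^ 2.
Proof.
  intros Hh. unfold eval_exact, Dxx, moment.
  assert (Hd : INR (S d) <> 0) by (apply not_0_INR; lia).
  rewrite (sumZ_ext _ _
    (fun k => a k * exact_average (fun t => (t - node h j) ^ d) h (j + k))
    (fun k => h ^ d * (a k * ((IZR (k + 1) ^ S d - IZR k ^ S d) / INR (S d))))).
  2:{ intros k _. unfold exact_average. rewrite RInt_shifted_pow. unfold node.
      replace (IZR (j + k + 1) * h - IZR j * h) with (IZR (k + 1) * h)
        by (rewrite !plus_IZR; ring).
      replace (IZR (j + k) * h - IZR j * h) with (IZR k * h)
        by (rewrite !plus_IZR; ring).
      rewrite !Rpow_mult_distr. rewrite <- (tech_pow_Rmult h d). field; auto. }
  rewrite (sumZ_ext _ _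
    (fun k => b k * exact_nodal (fun t => (t - node h j) ^ d) h (j + k))
    (fun k => h ^ d * (b k * IZR k ^ d))).
  2:{ intros k _. unfold exact_nodal, node.
      replace (IZR (j + k) * h - IZR j * h) with (IZR k * h)
        by (rewrite !plus_IZR; ring).
      rewrite Rpow_mult_distr. ring. }
  rewrite !sumZ_scal. field. exact Hh.
Qed.

Lemma smooth_pow (d : nat) : smooth (fun x => x ^ d).
Proof. intros n x. apply ex_derive_n_pow. Qed.

(** Let [h] tend to 0. Concretely, [h = min (h0 / 2, |u| / (2 (|K| + 1)))] gives [K h <= |u| / 2];
    the [+ 1] keeps the denominator positive when [K = 0]. *)
Lemma le_mult_pos_eq_0 (u K : R) :
  (exists h0, 0 < h0 /\ forall h, 0 < h < h0 -> Rabs u <= K * h) -> u = 0.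
Proof.
  intros (h0 & Hh0 & H).
  destruct (Req_dec u 0) as [|Hu]; trivial. exfalso.
  assert (HK : 0 < Rabs K + 1) by (pose proof (Rabs_pos K); lra).
  assert (Hu' : 0 < Rabs u) by now apply Rabs_pos_lt.
  set (e := Rabs u / (2 * (Rabs K + 1))).
  assert (He : 0 < e) by (unfold e; apply Rdiv_lt_0_compat; lra).
  set (h := Rmin (h0 / 2) e).
  assert (Hh : 0 < h) by (unfold h; apply Rmin_glb_lt; lra).
  assert (H1 : h <= h0 / 2) by apply Rmin_l.
  assert (H2 : h <= e) by apply Rmin_r.
  specialize (H h ltac:(lra)).
  assert (K * h <= (Rabs K + 1) * e).
  { apply Rle_trans with ((Rabs K + 1) * h).
    - apply Rmult_le_compat_r; [lra|]. pose proof (Rle_abs K). lra.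
    - apply Rmult_le_compat_l; lra. }
  replace ((Rabs K + 1) * e) with (Rabs u / 2) in H0 by (unfold e; field; lra).
  lra.
Qed.

(** On [x ^ d] at the node [0] the error is [h ^ (d - 2)] times the defect of the
    [d]-th moment, which is too large for an [O(h ^ (P + 2))] unless it is [0]. *)
Lemma order_accurate_moment (q q' : Z) (a b : Z -> R) (P d : nat) :
  order_accurate (Dxx q q' a b) P -> (d <= P + 1)%nat ->
  moment q q' a b d = if Nat.eqb d 2 then 2 else 0.
Proof.
  intros (HP & C & HC & H) Hd.
  destruct (H _ (smooth_pow d) 0 0) as (K & h0 & Hh0 & HK).
  set (D := if Nat.eqb d 2 then 2 else 0).
  apply Rminus_diag_uniq, (le_mult_pos_eq_0 _ K).
  (* With [h <= 1] the surplus powers of [h] in the final estimate are at most 1. *)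
  exists (Rmin h0 1); split; [apply Rmin_glb_lt; lra|].
  intros h (Hh & Hh'). apply Rmin_Rgt_l in Hh'. destruct Hh' as [Hh1 Hh2].
  assert (N0 : node h 0 = 0) by (unfold node; ring).
  specialize (HK h 0%Z ltac:(lra) ltac:(rewrite N0; lra)).
  (* Since [d < P + 2], the leading error term vanishes on [x ^ d], whatever [C] is. *)
  rewrite (Derive_n_pow_bigi (P + 2)), Rmult_0_r, Rmult_0_l, Rplus_0_r in HK by lia.
  replace (Derive_n (fun x => x ^ d) 2 (node h 0)) with (h ^ d * D / h ^ 2) in HK.
  2:{ rewrite N0. unfold D. destruct (Nat.eqb_spec d 2) as [->|Hd2].
      - rewrite Derive_n_pow_smalli by lia. simpl. field. lra.
      - destruct (Nat.lt_ge_cases d 2) as [Hd3|Hd3].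
        + rewrite Derive_n_pow_bigi by lia. field. lra.
        + rewrite Derive_n_pow_smalli by lia.
          rewrite (pow_i (d - 2)) by lia. field. 
          split; [|lra]. apply INR_fact_neq_0. }
  assert (E := eval_exact_shifted_pow q q' a b h 0 d ltac:(lra)).
  replace (eval_exact (Dxx q q' a b) (fun x => x ^ d) h 0)
    with (h ^ d * moment q q' a b d / h ^ 2) in HK.
  2:{ rewrite <- E. unfold eval_exact, Dxx.
    f_equal; f_equal; apply sumZ_ext; intros k _; f_equal.
      - unfold exact_average. f_equal. apply RInt_ext. intros t _. rewrite N0.
        f_equal; lra.
      - unfold exact_nodal. rewrite N0. f_equal; lra. }
  replace (h ^ d * moment q q' a b d / h ^ 2 - h ^ d * D / h ^ 2)
    with (h ^ d / h ^ 2 * (moment q q' a b d - D)) in HK by (field; lra).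
  assert (Hp : 0 < h ^ d) by (apply pow_lt; lra).
  assert (Hp2 : 0 < h ^ 2) by (apply pow_lt; lra).
  assert (HE : h ^ (P + 2) = h ^ d * h ^ (P + 2 - d)).
  { rewrite <- pow_add. f_equal. lia. }
  rewrite Rabs_mult, (Rabs_pos_eq (h ^ d / h ^ 2)) in HK
    by (left; apply Rdiv_lt_0_compat; lra).
  rewrite HE in HK.
  assert (HK2 : Rabs (moment q q' a b d - D) <= K * h * (h ^ (P + 1 - d) * h ^ 2)).
  { apply Rmult_le_reg_l with (h ^ d / h ^ 2); [apply Rdiv_lt_0_compat; lra|].
    eapply Rle_trans; [exact HK|]. right.
    replace (P + 2 - d)%nat with (S (P + 1 - d)) by lia. simpl. field. lra. }
  assert (Hq : 0 <= h ^ (P + 1 - d) * h ^ 2 <= 1).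
  { rewrite <- pow_add. split; [left; apply pow_lt; lra|].
    rewrite <- (pow1 (P + 1 - d + 2)). apply pow_incr; lra. }
  assert (HKh : 0 <= K * h * (h ^ (P + 1 - d) * h ^ 2)).
  { eapply Rle_trans; [apply Rabs_pos | exact HK2]. }
  eapply Rle_trans; [exact HK2|].
  (* The constant [K] comes without a sign; a negative one contradicts [HKh]. *)
  destruct (Rle_or_lt 0 K) as [HK0|HK0].
  - rewrite <- (Rmult_1_r (K * h)) at 2. apply Rmult_le_compat_l; [|lra].
    apply Rmult_le_pos; lra.
  - exfalso.
    assert (0 < h ^ (P + 1 - d) * h ^ 2) by (apply Rmult_lt_0_compat;
      [apply pow_lt|]; lra).
    assert (K * h < 0) by nra. nra.
Qed.

(** * Taylor's formula with a uniform remainder, and accuracy from moments *)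

Lemma continuous_bounded (f : R -> R) (lo hi : R) :
  (forall x, continuous f x) ->
  exists K, 0 <= K /\ forall x, lo <= x <= hi -> Rabs (f x) <= K.
Proof.
  intros Hf. destruct (Rle_or_lt lo hi) as [Hl|Hl].
  2:{ exists 0; split; [lra|]. intros x Hx. lra. }
  destruct (continuity_ab_maj (fun x => Rabs (f x)) lo hi Hl) as (M & HM & _).
  { intros c _. apply continuity_pt_filterlim.
    apply (continuous_comp f Rabs); [apply Hf | apply continuous_Rabs]. }
  exists (Rabs (f M)); split; [apply Rabs_pos | exact HM].
Qed.

Definition taylor (w : R -> R) (x : R) (n : nat) (t : R) : R :=
  sum_f_R0 (fun i => (t - x) ^ i / INR (fact i) * Derive_n w i x) n.

(** For [x < t] this is [Taylor_Lagrange]. For [t < x] it is the same formula for [s -> w (- s)]: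
    the signs [(-1) ^ m] of the reflected derivatives cancel those of the powers. *)
Lemma smooth_taylor (w : R -> R) (x t : R) (n : nat) :
  smooth w ->
  exists z, Rmin x t <= z <= Rmax x t /\
    w t = taylor w x n t
          + (t - x) ^ S n / INR (fact (S n)) * Derive_n w (S n) z.
Proof.
  intros Hw. destruct (Rtotal_order x t) as [H|[H|H]].
  - destruct (Taylor_Lagrange w n x t H) as (z & Hz & E); [intros; apply Hw|].
    exists z. rewrite Rmin_left, Rmax_right by lra. split; [lra | exact E].
  - subst t. exists x. rewrite Rmin_left, Rmax_left by lra. split; [lra|].
    unfold taylor. rewrite Rminus_diag, (pow_i (S n)) by lia.
    unfold Rdiv at 2. rewrite !Rmult_0_l, Rplus_0_r.
    induction n as [|n IH].
    + simpl. field.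
    + rewrite tech5, <- IH, (pow_i (S n)) by lia. unfold Rdiv. ring.
  - assert (Ho : forall m y, locally (- y) (fun s => forall k,
    (k <= m)%nat -> ex_derive_n w k s)).
    { intros m y. apply filter_forall. intros; apply Hw. }
    destruct (Taylor_Lagrange (fun s => w (- s)) n (- x) (- t)) as (z & Hz & E).
    { lra. }
    { intros. apply ex_derive_n_comp_opp, Ho. }
    exists (- z). rewrite Rmin_right, Rmax_left by lra. split; [lra|].
    rewrite Ropp_involutive in E. rewrite E.
    assert (Hs : forall m s, (- t - - x) ^ m * Derive_n (fun s => w (- s)) m s
                             = (t - x) ^ m * Derive_n w m (- s)).
    { intros m s. rewrite Derive_n_comp_opp by apply Ho.
      replace (- t - - x) with (-1 * (t - x)) by ring.
      rewrite Rpow_mult_distr.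
      assert (H1 : (-1) ^ m * (-1) ^ m = 1) by (rewrite <- Rpow_mult_distr;
        replace (-1 * -1) with 1 by ring; apply pow1).
      transitivity ((-1) ^ m * (-1) ^ m * ((t - x) ^ m * Derive_n w m (- s))); [ring|].
      rewrite H1; ring. }
    f_equal.
    + apply sum_eq. intros i _. unfold Rdiv.
      rewrite !(Rmult_comm _ (/ INR _)), !Rmult_assoc, Hs, Ropp_involutive. reflexivity.
    + unfold Rdiv. rewrite !(Rmult_comm _ (/ INR _)), !Rmult_assoc, Hs. reflexivity.
Qed.

(** One [K] serves all [x] in [[A, B]], because the intermediate point stays in [[A - r, B + r]],
    where the next derivative is bounded. This is the uniformity that [order_accurate] asks for. *)
Lemma smooth_taylor_bound (w : R -> R) (A B r : R) (n : nat) :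
  smooth w ->
  exists K, 0 <= K /\ forall x t, A <= x <= B -> Rabs (t - x) <= r ->
    Rabs (w t - taylor w x n t) <= K * Rabs (t - x) ^ S n.
Proof.
  intros Hw.
  destruct (continuous_bounded (Derive_n w (S n)) (A - r) (B + r)) as (K & HK0 & HK).
  { intros x. apply (ex_derive_continuous (Derive_n w (S n))), (Hw (S (S n)) x). }
  assert (Hf : 0 < INR (fact (S n))) by apply INR_fact_lt_0.
  exists (K / INR (fact (S n))). split.
  { apply Rmult_le_pos; [lra|]. left. now apply Rinv_0_lt_compat. }
  intros x t Hx Ht. destruct (smooth_taylor w x t n Hw) as (z & Hz & ->).
  replace (_ + _ - _) with ((t - x) ^ S n * / INR (fact (S n)) * Derive_n w (S n) z)
    by (unfold Rdiv; ring).
  rewrite !Rabs_mult, <- RPow_abs, (Rabs_pos_eq (/ _))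
    by (left; now apply Rinv_0_lt_compat).
  apply Rabs_le_between in Ht.
  assert (HKz : Rabs (Derive_n w (S n) z) <= K).
  { apply HK. revert Hz. unfold Rmin, Rmax. destruct Rle_dec; lra. }
  replace (K / INR (fact (S n)) * Rabs (t - x) ^ S n)
    with (Rabs (t - x) ^ S n * / INR (fact (S n)) * K) by (unfold Rdiv; ring).
  apply Rmult_le_compat_l; trivial.
  apply Rmult_le_pos; [apply pow_le, Rabs_pos|]. left. now apply Rinv_0_lt_compat.
Qed.

Lemma taylor_continuous (w : R -> R) (x : R) (n : nat) :
  forall t, continuous (taylor w x n) t.
Proof.
  intros t. apply (ex_derive_continuous (taylor w x n)).
  induction n as [|n IH]; unfold taylor; cbn [sum_f_R0]; [auto_derive; trivial|].
  apply (ex_derive_plus (taylor w x n)); [exact IH | auto_derive; trivial].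
Qed.

Lemma eval_exact_taylor (q q' : Z) (a b : Z -> R) (w : R -> R) (h : R) (j : Z)
  (n : nat) :
  h <> 0 ->
  eval_exact (Dxx q q' a b) (taylor w (node h j) n) h j =
  sum_f_R0 (fun i => Derive_n w i (node h j) / INR (fact i)
                     * (h ^ i * moment q q' a b i / h ^ 2)) n.
Proof.
  intros Hh. set (x := node h j).
  assert (Hc : forall i t, continuous (fun t => (t - x) ^ i) t).
  { intros i t. apply (ex_derive_continuous (fun t => (t - x) ^ i)).
    auto_derive; trivial. }
  assert (Hext : forall f g, (forall t, f t = g t) ->
    eval_exact (Dxx q q' a b) f h j = eval_exact (Dxx q q' a b) g h j).
  { intros f g Hfg. unfold eval_exact, Dxx.
    f_equal; f_equal; apply sumZ_ext; intros k _; f_equal;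
      unfold exact_average, exact_nodal; trivial.
    f_equal. apply RInt_ext; auto. }
  induction n as [|n IH]; cbn [sum_f_R0].
  - rewrite <- (eval_exact_shifted_pow q q' a b h j 0 Hh).
    fold x.
    (* The induction starts from [f = 0]; linearity with [f = g = 0] and [c = 1] gives [E = 2 E]. *)
    assert (E : eval_exact (Dxx q q' a b) (fun _ => 0) h j = 0).
    { generalize (eval_exact_linear q q' a b (fun _ => 0) (fun _ => 0) 1 h j
        (fun x => continuous_const _ _) (fun x => continuous_const _ _)).
      rewrite (Hext (fun t => 0 + 1 * 0) (fun _ => 0)) by (intros; ring). lra. }
    rewrite <- (Rplus_0_l (_ * _)), <- E at 1.
    rewrite <- eval_exact_linear; [| intros; apply continuous_const | apply Hc].
    apply Hext. intros t. unfold taylor. simpl. field.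
  - rewrite <- IH, <- (eval_exact_shifted_pow q q' a b h j (S n) Hh). fold x.
    rewrite <- eval_exact_linear; [| apply taylor_continuous | apply Hc].
    apply Hext. intros t. unfold taylor. cbn [sum_f_R0]. f_equal. unfold Rdiv. ring.
Qed.

(** [K] is the sum of the absolute values of the coefficients; the radius [(|q| + |q'|) h] covers
    every cell and node of the stencil. *)
Lemma eval_exact_bound (q q' : Z) (a b : Z -> R) :
  exists K, 0 <= K /\ forall (f : R -> R) (h M : R) (j : Z), 0 < h ->
    (forall x, continuous f x) ->
    (forall t, Rabs (t - node h j) <= (IZR (Z.abs q + Z.abs q')) * h -> Rabs (f
      t) <= M) ->
    Rabs (eval_exact (Dxx q q' a b) f h j) <= K * M / h ^ 2.
Proof.
  exists (sumZ (- q) (q - 1) (fun k => Rabs (a k)) + sumZ (- q') q' (fun k =>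
    Rabs (b k))).
  assert (Hs : forall lo hi c, 0 <= sumZ lo hi (fun k => Rabs (c k))).
  { intros. eapply Rle_trans; [apply Rabs_pos |].
    apply (sumZ_Rabs_le lo hi c). intros; lra. }
  split; [apply Rplus_le_le_0_compat; apply Hs|].
  intros f h M j Hh Hf HM.
  assert (Hh2 : 0 < / h ^ 2) by (apply Rinv_0_lt_compat, pow_lt, Hh).
  unfold eval_exact, Dxx, Rdiv.
  rewrite !Rmult_1_l, <- Rmult_plus_distr_l, Rabs_mult, (Rabs_pos_eq (/ _)) by lra.
  rewrite Rmult_comm. apply Rmult_le_compat_r; [lra|].
  eapply Rle_trans; [apply Rabs_triang|]. rewrite Rmult_plus_distr_r.
  assert (Hn : forall k, (Z.abs k <= Z.abs q + Z.abs q')%Z -> 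
     Rabs (IZR k * h) <= IZR (Z.abs q + Z.abs q') * h).
  { intros k Hk. rewrite Rabs_mult, <- abs_IZR, (Rabs_pos_eq h) by lra.
    apply Rmult_le_compat_r; [lra|]. now apply IZR_le. }
  apply Rplus_le_compat; rewrite Rmult_comm, <- sumZ_scal; apply sumZ_Rabs_le;
    intros k Hk; rewrite Rabs_mult, Rmult_comm; (apply Rmult_le_compat_r;
      [apply Rabs_pos|]).
  - unfold exact_average. unfold Rdiv. rewrite Rmult_1_l, Rabs_mult, (Rabs_pos_eq (/ h))
      by (left; now apply Rinv_0_lt_compat).
    assert (E : node h (j + k + 1) - node h (j + k) = h).
    { unfold node. rewrite !plus_IZR. ring. }
    apply Rmult_le_reg_l with h; trivial.
      rewrite <- Rmult_assoc, Rinv_r, Rmult_1_l by lra.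
    replace (h * M) with ((node h (j + k + 1) - node h (j + k)) * M)
      by (rewrite E; ring).
    apply abs_RInt_le_const; [lra| apply (ex_RInt_continuous f); auto |].
    intros t Ht. apply HM. 
    assert (H1 := Hn k ltac:(lia)). assert (H2 := Hn (k + 1)%Z ltac:(lia)).
    apply Rabs_le_between in H1. apply Rabs_le_between in H2.
    apply Rabs_le_between. revert Ht H1 H2. unfold node. rewrite !plus_IZR. intros. nra.
  - unfold exact_nodal. apply HM.
    replace (node h (j + k) - node h j) with (IZR k * h).
    2:{ unfold node. rewrite plus_IZR. ring. }
    apply Hn. lia.
Qed.

(** Expand to degree [P + 3]: the moments up to [P + 1] reproduce the second derivative, moment
    [P + 2] gives the error constant, and since moment [P + 3] vanishes the rest is of size
    [h ^ (P + 4) / h ^ 2]. *)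
Lemma moment_order_accurate (q q' : Z) (a b : Z -> R) (P : nat) :
  (1 <= P)%nat ->
  (forall d, (d <= P + 1)%nat -> moment q q' a b d = if Nat.eqb d 2 then 2 else 0) ->
  moment q q' a b (P + 2) <> 0 -> moment q q' a b (P + 3) = 0 ->
  order_accurate (Dxx q q' a b) P.
Proof.
  intros HP Hlow Hmid Hhigh. split; trivial.
  assert (Hfact : INR (fact (P + 2)) <> 0) by apply INR_fact_neq_0.
  exists (moment q q' a b (P + 2) / INR (fact (P + 2))). split.
  { unfold Rdiv. apply Rmult_integral_contrapositive. split; trivial.
    now apply Rinv_neq_0_compat. }
  intros w Hw A B.
  set (L := IZR (Z.abs q + Z.abs q')).
  assert (HL : 0 <= L) by (apply IZR_le; lia).
  destruct (smooth_taylor_bound w A B L (P + 3) Hw) as (K1 & HK1 & HT).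
  destruct (eval_exact_bound q q' a b) as (K2 & HK2 & HE).
  (* Taking [h0 = 1] keeps the stencil radius [L * h] below the radius [L] of the Taylor bound. *)
  exists (K2 * (K1 * L ^ S (P + 3))), 1. split; [lra|].
  intros h j Hh Hj. set (x := node h j) in *.
  assert (Hmain : eval_exact (Dxx q q' a b) (taylor w x (P + 3)) h j =
    Derive_n w 2 x + moment q q' a b (P + 2) / INR (fact (P + 2)) * Derive_n w
      (P + 2) x * h ^ P).
  { unfold x at 1. rewrite eval_exact_taylor by lra. fold x.
    replace (P + 3)%nat with (S (S (P + 1))) by lia. cbn [sum_f_R0].
    replace (S (S (P + 1))) with (P + 3)%nat by lia.
    replace (S (P + 1)) with (P + 2)%nat by lia.
    rewrite Hhigh.
    assert (Hs : forall n, (n <= P + 1)%nat -> (2 <= n)%nat ->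
       sum_f_R0 (fun i => Derive_n w i x / INR (fact i) * (h ^ i * moment q q'
         a b i / h ^ 2)) n
       = Derive_n w 2 x).
    { intros n Hn. induction n as [|n IH]; [lia|]. intros Hn2.
      cbn [sum_f_R0]. destruct (Nat.eq_dec n 1) as [->|Hn1].
      - cbn [sum_f_R0]. rewrite !Hlow by lia. simpl. field. lra.
      - rewrite IH by lia. rewrite (Hlow (S n)) by lia.
        replace (Nat.eqb (S n) 2) with false by (symmetry; apply Nat.eqb_neq; lia).
        unfold Rdiv. ring. }
    rewrite Hs by lia. rewrite pow_add. field.
      repeat split; (apply INR_fact_neq_0 || lra). }
  rewrite <- Hmain.
  assert (Hct := taylor_continuous w x (P + 3)).
  assert (Hcw := smooth_continuous w Hw).
  assert (Hlin := eval_exact_linear q q' a b w (taylor w x (P + 3)) (-1) h j Hcw Hct).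
  replace (_ - _) with (eval_exact (Dxx q q' a b)
    (fun t => w t + -1 * taylor w x (P + 3) t) h j) by lra.
  eapply Rle_trans.
  { apply (HE _ h (K1 * (L * h) ^ S (P + 3))); [lra| |].
    - intros t. apply (continuous_plus w); [apply Hcw|].
      apply (continuous_scal_r (-1) (taylor w x (P + 3))), Hct.
    - intros t Ht. replace (w t + _) with (w t - taylor w x (P + 3) t) by ring.
      eapply Rle_trans.
      + apply HT; trivial. fold x L in Ht. eapply Rle_trans; [exact Ht|].
        rewrite <- (Rmult_1_r L) at 2. apply Rmult_le_compat_l; lra.
      + apply Rmult_le_compat_l; trivial. apply pow_incr.
        split; [apply Rabs_pos | exact Ht]. }
  right. rewrite Rpow_mult_distr. replace (S (P + 3)) with (P + 2 + 2)%nat by lia.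
  rewrite (pow_add h (P + 2) 2). field. lra.
Qed.

Module Algebra_of_stencils.
Import all_boot all_order all_algebra.
Import ring zify ssrZ Rstruct.
Set Implicit Arguments.
Unset Strict Implicit.
Unset Printing Implicit Defensive.
Import Order.TTheory GRing.Theory Num.Theory.
Delimit Scope Z_scope with Z.
Delimit Scope R_scope with coqR.
Bind Scope ring_scope with R.
Local Open Scope ring_scope.

(** * Hermite interpolation *)

Section Hermite.
Variable F : fieldType.
Implicit Types (s t : seq F) (x y z : F) (p W : {poly F}).

Definition nodal s : {poly F} := \prod_(y <- s) ('X - y%:P).

Lemma nodal_eq0 s y : y \in s -> (nodal s).[y] = 0.
Proof. by move=> ys; apply/eqP; rewrite -/(root _ _) root_prod_XsubC. Qed.

Lemma nodal_neq0 s y : y \notin s -> (nodal s).[y] != 0.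
Proof. by rewrite -/(root _ _) root_prod_XsubC. Qed.

Lemma nodalE s x : (nodal s).[x] = \prod_(y <- s) (x - y).
Proof.
by rewrite /nodal horner_prod; apply: eq_bigr => y _; rewrite hornerXsubC.
Qed.

Lemma nodal_rem s z : z \in s -> nodal s = ('X - z%:P) * nodal (rem z s).
Proof. by move=> zs; rewrite /nodal (big_rem z). Qed.

(** The logarithmic derivative of a product; through it the sums [zeta] enter the weights. *)
Lemma nodal_log_deriv s z : z \notin s ->
  (nodal s)^`().[z] / (nodal s).[z] = \sum_(y <- s) (z - y)^-1.
Proof.
elim: s => [|y s IH]; first by rewrite /nodal !big_nil derivC horner0 mul0r.
rewrite inE negb_or => /andP[zy zs].
rewrite big_cons -IH // /nodal big_cons -/(nodal s).
rewrite derivM derivXsubC mul1r hornerD !hornerM hornerXsubC.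
have := nodal_neq0 zs.
have: z - y != 0 by rewrite subr_eq0.
by move=> *; field; apply/andP; split.
Qed.

Variables s t : seq F.
Hypotheses (us : uniq s) (ut : uniq t) (ts : {subset t <= s}).

(** [hermite_val z] and [hermite_der z] are the cardinal polynomials of the data
    [p(z)], [z \in s], and [p'(z)], [z \in t].  When [z \notin t], [rem z t] is [t]
    and [hermite_slope z] is [0]. *)
Definition hermite_quot z : {poly F} := nodal (rem z s) * nodal (rem z t).
Definition hermite_slope z : F :=
  if z \in t then (hermite_quot z)^`().[z] / (hermite_quot z).[z] else 0.
Definition hermite_val z : {poly F} :=
  (hermite_quot z).[z]^-1 *: ((1 - hermite_slope z *: ('X - z%:P)) * hermite_quot z).
Definition hermite_der z : {poly F} :=
  (hermite_quot z).[z]^-1 *: (('X - z%:P) * hermite_quot z).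

Lemma rem_notin z (r : seq F) : uniq r -> z \notin rem z r.
Proof. by move=> ur; rewrite mem_rem_uniq // inE eqxx. Qed.

Lemma hermite_quot_neq0 z : (hermite_quot z).[z] != 0.
Proof.
by rewrite hornerM mulf_eq0 negb_or !nodal_neq0 // rem_notin.
Qed.

Lemma hermite_quot_eq0 y z : y \in s -> y != z -> (hermite_quot z).[y] = 0.
Proof.
move=> ys yz; rewrite hornerM nodal_eq0 ?mul0r //.
by rewrite mem_rem_uniq // inE yz.
Qed.

(** As [t] is contained in [s], such a [y] is a root of both factors, hence a double root. *)
Lemma hermite_quot_deriv_eq0 y z : y \in t -> y != z -> (hermite_quot z)^`().[y] = 0.
Proof.
move=> yt yz; rewrite derivM hornerD !hornerM.
by rewrite !(@nodal_eq0 (rem z _) y) ?mulr0 ?mul0r ?addr0 // mem_rem_uniq //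
  inE yz // ts.
Qed.

(** Both cardinal polynomials are a scalar times an [affine] factor times [hermite_quot], so values,
    derivatives and coefficients are computed once for this shape. *)
Definition affine (c a : F) z : {poly F} := c%:P + a *: ('X - z%:P).

Lemma horner_affine (k c a : F) (z y : F) (Q : {poly F}) :
  (k *: (affine c a z * Q)).[y] = k * ((c + a * (y - z)) * Q.[y]).
Proof. by rewrite hornerZ hornerM hornerD hornerZ hornerXsubC hornerC. Qed.

Lemma deriv_affine (k c a : F) (z y : F) (Q : {poly F}) :
  (k *: (affine c a z * Q))^`().[y]
  = k * (a * Q.[y] + (c + a * (y - z)) * Q^`().[y]).
Proof.
rewrite derivZ derivM derivD derivC add0r derivZ derivXsubC.
rewrite hornerZ hornerD !hornerM hornerD !hornerZ hornerXsubC !hornerC; ring.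
Qed.

Lemma hermite_valE z :
  hermite_val z =
  (hermite_quot z).[z]^-1 *: (affine 1 (- hermite_slope z) z * hermite_quot z).
Proof. by rewrite /affine scaleNr. Qed.

Lemma hermite_derE z :
  hermite_der z = (hermite_quot z).[z]^-1 *: (affine 0 1 z * hermite_quot z).
Proof. by rewrite /affine scale1r add0r. Qed.

Lemma hermite_val_horner y z : y \in s -> (hermite_val z).[y] = (y == z)%:R.
Proof.
move=> ys; rewrite hermite_valE horner_affine; case: eqVneq => [->|yz].
  by rewrite subrr mulr0 addr0 mul1r mulVf ?hermite_quot_neq0.
by rewrite (hermite_quot_eq0 ys yz) !mulr0.
Qed.

(** At [y = z] the slope is chosen to cancel the logarithmic derivative of the quotient; any other
    [y] in [t] is a double root. *)
Lemma hermite_val_deriv y z : y \in t -> (hermite_val z)^`().[y] = 0.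
Proof.
move=> yt; rewrite hermite_valE deriv_affine; case: (eqVneq y z) => [yz|yz]; last first.
  by rewrite (hermite_quot_eq0 (ts yt) yz) (hermite_quot_deriv_eq0 yt yz)
    !(mulr0, add0r).
rewrite /hermite_slope -yz yt; have Q0 := hermite_quot_neq0 y; by field.
Qed.

Lemma hermite_der_horner y z : y \in s -> (hermite_der z).[y] = 0.
Proof.
move=> ys; rewrite hermite_derE horner_affine; case: (eqVneq y z) => [->|yz].
  by rewrite subrr !(mul0r, mulr0, addr0).
by rewrite (hermite_quot_eq0 ys yz) !mulr0.
Qed.

Lemma hermite_der_deriv y z : y \in t -> (hermite_der z)^`().[y] = (y == z)%:R.
Proof.
move=> yt; rewrite hermite_derE deriv_affine; case: eqVneq => [->|yz].
  by rewrite subrr !(mulr0, addr0, mul0r, mul1r) mulVf ?hermite_quot_neq0.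
by rewrite (hermite_quot_eq0 (ts yt) yz) (hermite_quot_deriv_eq0 yt yz) !(mulr0, add0r).
Qed.

Lemma size_nodal r : size (nodal r) = (size r).+1.
Proof. by rewrite size_prod_XsubC. Qed.

Lemma nodal_monic r : nodal r \is monic.
Proof. exact: monic_prod_XsubC. Qed.

(** The summand [(z \in t)] reserves the degree taken up by the nonconstant [affine] factor. *)
Lemma size_hermite_quot z : z \in s ->
  (size (hermite_quot z) + (z \in t) <= size s + size t)%N.
Proof.
clear us ut ts; move=> zs; rewrite /hermite_quot size_monicM ?nodal_monic
  ?monic_neq0 ?nodal_monic //.
rewrite !size_nodal size_rem //.
have s0 : (0 < size s)%N by case: (s) zs.
case zt: (z \in t).
  have t0 : (0 < size t)%N by case: (t) zt.
  by rewrite size_rem //= addn1; lia.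
by rewrite rem_id ?zt //= addn0; lia.
Qed.

Lemma size_affine (c a : F) z : (size (affine c a z) <= 2)%N.
Proof.
apply: leq_trans (size_polyD _ _) _; rewrite geq_max; apply/andP; split.
  by rewrite size_polyC; case: eqP.
by apply: leq_trans (size_scale_leq _ _) _; rewrite size_XsubC.
Qed.

Lemma size_hermite_val z : z \in s -> (size (hermite_val z) <= size s + size t)%N.
Proof.
clear us ut ts; move=> zs; rewrite hermite_valE;
  apply: leq_trans (size_scale_leq _ _) _.
apply: leq_trans (size_polyMleq _ _) _; move: (size_hermite_quot zs);
  rewrite /hermite_slope.
case: ifP => zt.
  rewrite addn1; set L := affine _ _ _; have : (size L <= 2)%N by exact: size_affine.
  by lia.
by rewrite oppr0 /affine scale0r addr0 size_poly1 addn0; lia.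
Qed.

Lemma size_hermite_der z : z \in t -> (size (hermite_der z) <= size s + size t)%N.
Proof.
clear us ut; move=> zt; apply: leq_trans (size_scale_leq _ _) _.
apply: leq_trans (size_polyMleq _ _) _; rewrite size_XsubC.
by move: (size_hermite_quot (ts zt)); rewrite zt addn1; lia.
Qed.

(** Write [W = V * nodal s]. At [y] in [t] the derivative of [W] is [V.[y]] times a nonzero product,
    so [V] vanishes on all of [t]; its degree is below the size of [t], hence [V = 0]. *)
Lemma hermite_unique W : (size W <= size s + size t)%N ->
  {in s, forall y, W.[y] = 0} -> {in t, forall y, W^`().[y] = 0} -> W = 0.
Proof.
move=> sW Ws Wt.
have sW0 : all (root W) s by apply/allP => y /Ws Wy; apply/eqP.
have := uniq_roots_dvdp sW0; rewrite uniq_rootsE us => /(_ isT) /dvdpP [V WV].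
rewrite -/(nodal s) in WV.
have V0 : V = 0.
  apply: (@roots_geq_poly_eq0 _ _ t); rewrite ?ut //.
    apply/allP => y yt; apply/eqP; have := Wt y yt.
    rewrite WV derivM hornerD !hornerM nodal_eq0 ?ts // mulr0 add0r.
    rewrite (nodal_rem (ts yt)) derivM derivXsubC mul1r hornerD hornerM.
    rewrite hornerXsubC subrr mul0r addr0 => /eqP.
    by rewrite mulf_eq0 (negbTE (nodal_neq0 (rem_notin _ us))) orbF => /eqP.
  have [->|V0] := eqVneq V 0; first by rewrite size_poly0.
  by move: sW; rewrite WV size_Mmonic ?nodal_monic // size_nodal addnS /= addnC
    leq_add2l.
by rewrite WV V0 mul0r.
Qed.

Lemma coef_comp_opp p i : (p \Po (- 'X))`_i = (-1) ^+ i * p`_i.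
Proof.
rewrite coef_comp_poly; under eq_bigr => j _.
  rewrite exprNn -signr_odd mulr_sign (fun_if (fun q : {poly F} => q`_i)).
  rewrite coefN coefXn -mulr_sign signr_odd; over.
have [ip|pi] := ltnP i (size p).
  rewrite (bigD1 (Ordinal ip)) //= eqxx mulr1 mulrC big1 ?addr0 // => j ji.
  by rewrite eq_sym (negbTE (ji : (j != i :> nat))) !mulr0.
rewrite (nth_default _ pi) mulr0 big1 // => j _.
by rewrite gtn_eqF ?mulr0 // (leq_trans (ltn_ord j)).
Qed.

Lemma size_comp_opp p : size (p \Po (- 'X)) = size p.
Proof. by rewrite size_comp_poly2 // size_polyN size_polyX. Qed.

Section Symmetric.
Hypotheses (sN : forall y, (- y \in s) = (y \in s)).
Hypotheses (tN : forall y, (- y \in t) = (y \in t)).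

(** Both sides have the same Hermite data, so [hermite_unique] applies. In the next lemma
    differentiating the reflection brings the minus sign. *)
Lemma hermite_val_opp z : z \in s -> hermite_val (- z) \Po (- 'X) = hermite_val z.
Proof.
move=> zs; apply/eqP; rewrite -subr_eq0; apply/eqP; apply: hermite_unique.
- apply: leq_trans (size_polyD _ _) _.
  by rewrite size_polyN size_comp_opp geq_max !size_hermite_val ?sN.
- move=> y ys; rewrite hornerD hornerN horner_comp hornerN hornerX.
  by rewrite !hermite_val_horner ?sN // eqr_opp subrr.
- move=> y yt; rewrite derivB deriv_comp derivN derivX hornerD hornerN hornerM.
  by rewrite horner_comp hornerN hornerX !hermite_val_deriv ?tN // mul0r subrr.
Qed.

Lemma hermite_der_opp z : z \in t -> hermite_der (- z) \Po (- 'X) = - hermite_der z.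
Proof.
move=> zt; apply/eqP; rewrite -addr_eq0; apply/eqP; apply: hermite_unique.
- apply: leq_trans (size_polyD _ _) _.
  by rewrite size_comp_opp geq_max !size_hermite_der ?tN.
- move=> y ys; rewrite hornerD horner_comp hornerN hornerX.
  by rewrite !hermite_der_horner ?sN // addr0.
- move=> y yt; rewrite derivD deriv_comp derivN derivX hornerD hornerM.
  rewrite horner_comp hornerN hornerX !hermite_der_deriv ?tN // eqr_opp.
  by rewrite hornerN hornerC mulrN1 addNr.
Qed.
End Symmetric.

(** For [i = 2] this reduces the third coefficient of a cardinal polynomial to the coefficients 2
    and 3 of its quotient. *)
Lemma coef_affineM (k c a z : F) (Q : {poly F}) i :
  (k *: (affine c a z * Q))`_i.+1 = k * ((c - a * z) * Q`_i.+1 + a * Q`_i).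
Proof.
by rewrite coefZ /affine mulrDl coefD coefCM -scalerAl coefZ mulrBl coefB
  coefXM coefCM /=; ring.
Qed.

Definition hermite (u v : F -> F) : {poly F} :=
  \sum_(z <- s) u z *: hermite_val z + \sum_(z <- t) v z *: hermite_der z.

Lemma size_hermite u v : (size (hermite u v) <= size s + size t)%N.
Proof.
apply: leq_trans (size_polyD _ _) _; rewrite geq_max; apply/andP; split.
  apply: leq_trans (size_sum _ _ _) _; apply/bigmax_leqP_seq => z zs _.
  exact: leq_trans (size_scale_leq _ _) (size_hermite_val zs).
apply: leq_trans (size_sum _ _ _) _; apply/bigmax_leqP_seq => z zt _.
exact: leq_trans (size_scale_leq _ _) (size_hermite_der zt).
Qed.

Lemma sum_delta (r : seq F) (u : F -> F) y : uniq r -> y \in r ->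
  \sum_(z <- r) u z * (y == z)%:R = u y.
Proof.
move=> ur yr; rewrite (big_rem y) //= eqxx mulr1 big_seq big1 ?addr0 // => z.
by rewrite mem_rem_uniq // inE eq_sym => /andP[/negbTE -> _]; rewrite mulr0.
Qed.

Lemma hermite_horner u v y : y \in s -> (hermite u v).[y] = u y.
Proof.
move=> ys; rewrite hornerD !horner_sum -[RHS]addr0; congr (_ + _).
  rewrite -(sum_delta u us ys).
  by apply: eq_bigr => z _; rewrite hornerZ hermite_val_horner.
by apply: big1 => z _; rewrite hornerZ hermite_der_horner // mulr0.
Qed.

Lemma hermite_deriv u v y : y \in t -> (hermite u v)^`().[y] = v y.
Proof.
move=> yt; rewrite derivD !(raddf_sum (@deriv F)) hornerD !horner_sum -[RHS]add0r.
congr (_ + _).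
  by apply: big1 => z _; rewrite /= derivZ hornerZ hermite_val_deriv // mulr0.
rewrite -(sum_delta v ut yt).
by apply: eq_bigr => z _; rewrite /= derivZ hornerZ hermite_der_deriv.
Qed.

Lemma hermite_interpolation W : (size W <= size s + size t)%N ->
  hermite (fun z => W.[z]) (fun z => W^`().[z]) = W.
Proof.
move=> sW; apply/eqP; rewrite -subr_eq0; apply/eqP; apply: hermite_unique.
- by apply: leq_trans (size_polyD _ _) _; rewrite size_polyN geq_max size_hermite.
- by move=> y ys; rewrite hornerD hornerN hermite_horner // subrr.
- by move=> y yt; rewrite derivB hornerD hornerN hermite_deriv // subrr.
Qed.

End Hermite.

(** * Symmetric integer nodes *)

Lemma eqZE (k l : Z) : (k == l) = (k =? l)%Z.
Proof. by []. Qed.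

Definition zseq (lo : Z) (n : nat) : seq Z :=
  [seq (lo + Z.of_nat i)%Z | i <- List.seq 0 n].

Lemma List_seqE m n : List.seq m n = iota m n.
Proof. by elim: n m => //= n IH m; rewrite IH. Qed.

Lemma sumZE lo hi f :
  sumZ lo hi f = \sum_(k <- zseq lo (Z.to_nat (hi - lo + 1))) f k.
Proof.
rewrite /sumZ /zseq.
by elim: (List.seq _ _) => [|i s IH]; rewrite ?big_nil //= big_cons IH.
Qed.

Lemma zseq_cons lo n : zseq lo n.+1 = lo :: zseq (lo + 1) n.
Proof.
rewrite /zseq /= Z.add_0_r; congr (_ :: _).
rewrite !List_seqE (iotaDl 1 0) -map_comp; apply: eq_map => i /=; lia.
Qed.

Lemma zseq_cat lo m n : zseq lo (m + n) = zseq lo m ++ zseq (lo + Z.of_nat m) n.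
Proof.
elim: m lo => [|m IH] lo; first by rewrite Z.add_0_r.
rewrite addSn !zseq_cons IH /=; congr (_ :: (_ ++ zseq _ _)); lia.
Qed.

Lemma zseq_rcons lo n : zseq lo n.+1 = rcons (zseq lo n) (lo + Z.of_nat n)%Z.
Proof. by rewrite -addn1 zseq_cat (zseq_cons _ 0) cats1. Qed.

Lemma mem_zseq lo n (k : Z) :
  (k \in zseq lo n) = (lo <=? k)%Z && (k <? lo + Z.of_nat n)%Z.
Proof.
elim: n lo => [|n IH] lo; first by rewrite /zseq /= in_nil; lia.
by rewrite zseq_cons inE eqZE IH; lia.
Qed.

Lemma uniq_zseq lo n : uniq (zseq lo n).
Proof.
by elim: n lo => [|n IH] lo //; rewrite zseq_cons /= IH mem_zseq; lia.
Qed.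

Definition zsym (n : nat) : seq Z := zseq (- Z.of_nat n) (n + n).+1.

(** Peeling off both ends at once allows inductions on [n] that treat the nodes in pairs. *)
Lemma zsymS n : zsym n.+1 =
  (- Z.of_nat n.+1)%Z :: rcons (zsym n) (Z.of_nat n.+1).
Proof.
rewrite /zsym addnS zseq_cons; congr (_ :: _).
have -> : (- Z.of_nat n.+1 + 1 = - Z.of_nat n)%Z by lia.
rewrite addSn [LHS]zseq_rcons; congr rcons; lia.
Qed.

Lemma mem_zsym n (k : Z) : (k \in zsym n) = (Z.abs k <=? Z.of_nat n)%Z.
Proof. rewrite mem_zseq; lia. Qed.

Lemma size_zseq lo n : size (zseq lo n) = n.
Proof. by rewrite size_map List_seqE size_iota. Qed.

Lemma perm_zsym_opp n : perm_eq (map Z.opp (zsym n)) (zsym n).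
Proof.
apply: uniq_perm; rewrite ?uniq_zseq //.
  by rewrite map_inj_uniq ?uniq_zseq // => x y; exact: Z.opp_inj.
move=> k; rewrite mem_zsym; apply/mapP/idP => [[l]|kn].
  by rewrite mem_zsym => ? ->; lia.
by exists (- k)%Z; rewrite ?mem_zsym; lia.
Qed.

Lemma sum_zsym_opp n (f : Z -> R) :
  \sum_(k <- zsym n) f (- k)%Z = \sum_(k <- zsym n) f k.
Proof.
by rewrite -(big_map Z.opp xpredT f); apply: perm_big; exact: perm_zsym_opp.
Qed.

Lemma IZR_inj : injective IZR.
Proof. exact: eq_IZR. Qed.

Definition nodes (n : nat) : seq R := [seq IZR k | k <- zsym n].

Lemma uniq_nodes n : uniq (nodes n).
Proof. by rewrite map_inj_uniq ?uniq_zseq //; exact: IZR_inj. Qed.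

Lemma mem_nodes n k : (IZR k \in nodes n) = (Z.abs k <=? Z.of_nat n)%Z.
Proof. by rewrite mem_map ?mem_zsym //; exact: IZR_inj. Qed.

Lemma size_nodes n : size (nodes n) = (n + n).+1.
Proof. by rewrite size_map size_zseq. Qed.

Lemma big_nodes_rem (T : Type) (idx : T) (op : Monoid.law idx) n k (f : R -> T) :
  \big[op/idx]_(y <- rem (IZR k) (nodes n)) f y =
  \big[op/idx]_(l <- zsym n | l != k) f (IZR l).
Proof.
rewrite rem_filter ?uniq_nodes // big_filter big_map.
by apply: eq_bigl => l /=; rewrite (inj_eq IZR_inj).
Qed.

Lemma prod_zseq_below lo n :
  \prod_(k <- zseq lo n) (IZR (lo + Z.of_nat n) - IZR k) = n`!%:R.
Proof.
elim: n lo => [|n IH] lo; first by rewrite big_nil.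
rewrite zseq_cons big_cons factS natrM; congr (_ * _).
  by rewrite -[_ - _]minus_IZR -INRE INR_IZR_INZ; congr IZR; lia.
by rewrite -(IH (lo + 1)%Z); apply: eq_bigr => k _; congr (IZR _ - _); lia.
Qed.

Lemma prod_zseq_above k n :
  \prod_(l <- zseq (k + 1) n) (IZR k - IZR l) = (-1) ^+ n * n`!%:R.
Proof.
elim: n => [|n IH]; first by rewrite big_nil mul1r.
rewrite zseq_rcons -cats1 big_cat big_seq1 IH /= factS natrM exprS.
have -> : IZR k - IZR (k + 1 + Z.of_nat n) = - n.+1%:R.
  by rewrite -[_ - _]minus_IZR -INRE INR_IZR_INZ -RoppE -opp_IZR; congr IZR; lia.
ring.
Qed.

(** Split the list at [k]: the nodes below give [(n + k)!], the [n - k] nodes above give negative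
    factors, whence the sign and [(n - k)!]. *)
Lemma prod_zsym n k : (Z.abs k <= Z.of_nat n)%Z ->
  \prod_(l <- zsym n | l != k) (IZR k - IZR l)
  = (-1) ^+ Z.to_nat (Z.of_nat n - k) *
    (Z.to_nat (Z.of_nat n + k))`!%:R * (Z.to_nat (Z.of_nat n - k))`!%:R.
Proof.
move=> kn; set a := Z.to_nat (_ + k); set b := Z.to_nat _.
have E : zsym n = zseq (- Z.of_nat n) a ++ k :: zseq (k + 1) b.
  rewrite /zsym; have -> : (n + n).+1 = (a + b.+1)%N by rewrite /a /b; lia.
  rewrite zseq_cat zseq_cons; have -> // : (- Z.of_nat n + Z.of_nat a)%Z = k
    by rewrite /a; lia.
rewrite E big_cat big_cons eqxx /=.
have F lo m : k \notin zseq lo m -> \prod_(l <- zseq lo m | l != k) (IZR k - IZR l) 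
   = \prod_(l <- zseq lo m) (IZR k - IZR l).
  move=> kl; rewrite big_seq_cond [RHS]big_seq; apply: eq_bigl => l.
  by case lz: (l \in _) => //=; apply: contraNneq kl => <-.
rewrite !F ?mem_zseq; [|lia|lia].
rewrite prod_zseq_above mulrCA mulrA; congr (_ * _ * _).
rewrite -(prod_zseq_below (- Z.of_nat n)); apply: eq_bigr => l _.
by congr (IZR _ - _); rewrite /a; lia.
Qed.

Lemma big_zsymS (T : Type) (idx : T) (op : Monoid.law idx) n (f : Z -> T) :
  \big[op/idx]_(k <- zsym n.+1 | k != Z0) f k =
  op (f (- Z.of_nat n.+1)%Z)
     (op (\big[op/idx]_(k <- zsym n | k != Z0) f k) (f (Z.of_nat n.+1))).
Proof.
rewrite zsymS big_cons -cats1 big_cat big_cons big_nil !eqZE.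
have -> : (- Z.of_nat n.+1 =? 0)%Z = false by lia.
have -> : (Z.of_nat n.+1 =? 0)%Z = false by lia.
by rewrite Monoid.mulm1.
Qed.

Lemma big_zsym0 (T : Type) (idx : T) (op : Monoid.law idx) (f : Z -> T) :
  \big[op/idx]_(k <- zsym 0 | k != Z0) f k = idx.
Proof. by rewrite big_cons big_nil. Qed.

(** The product of the [X - k] with [0 < |k| <= n]. *)
Definition core n : {poly R} := nodal (rem 0 (nodes n)).

(** The two new nodes contribute a single factor in ['X^2], so [core] is even. *)
Lemma coreS n :
  core n.+1 = core n * ('X^2 - (n.+1%:R ^+ 2)%:P).
Proof.
have E m : core m = \prod_(l <- zsym m | l != Z0) ('X - (IZR l)%:P).
  by rewrite /core /nodal (big_nodes_rem _ _ Z0).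
rewrite !E big_zsymS opp_IZR -INR_IZR_INZ INRE RoppE rmorphN rmorphXn /=; ring.
Qed.

Lemma core0 : core 0 = 1.
Proof. by rewrite /core /nodal (big_nodes_rem _ _ Z0) big_zsym0. Qed.

Lemma nodal_nodes n : nodal (nodes n) = 'X * core n.
Proof.
rewrite (@nodal_rem _ _ 0) ?subr0 //.
have := mem_nodes n Z0 => /= ->; lia.
Qed.

Lemma coef_mulX2B p (a : R) i :
  (p * ('X^2 - a%:P))`_i = (if (i < 2)%N then 0 else p`_(i - 2)) - p`_i * a.
Proof. by rewrite mulrBr coefB coefMXn coefMC. Qed.

Lemma core_coef1 n : (core n)`_1 = 0.
Proof.
elim: n => [|n IH]; first by rewrite core0 coef1.
by rewrite coreS coef_mulX2B IH mul0r subr0.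
Qed.

Lemma core_coef0_neq0 n : (core n)`_0 != 0.
Proof.
rewrite -horner_coef0 nodal_neq0 // rem_notin // uniq_nodes //.
Qed.

(** In the product of the ['X^2 - j^2] the ratio of coefficients 2 and 0 is minus the sum of
    [1 / j^2] over [1 <= j <= n], half the sum over all [k] other than 0; the factor 6 makes this
    [3 / k^2]. *)
Lemma core_coef2 n :
  (core n)`_2 * 6 =
  - (core n)`_0 * \sum_(k <- zsym n | k != Z0) (3 / IZR k ^+ 2).
Proof.
elim: n => [|n IH].
  by rewrite core0 !coef1 mul0r big_zsym0 mulr0.
rewrite big_zsymS opp_IZR -INR_IZR_INZ INRE RoppE sqrrN coreS !coef_mulX2B /=
  sub0r subnn.
have nz : n.+1%:R != 0 :> R by rewrite pnatr_eq0.
by rewrite mulrBl mulrAC IH; field; rewrite nat1r.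
Qed.

Lemma factE n : Factorial.fact n = n`!.
Proof. by elim: n => //= n IH; rewrite IH factS mulSn. Qed.

Lemma nodesN n y : (- y \in nodes n) = (y \in nodes n).
Proof.
suff H x : x \in nodes n -> - x \in nodes n.
  by apply/idP/idP => /H //; rewrite opprK.
case/mapP => k kn ->; rewrite -RoppE -opp_IZR mem_nodes.
by move: kn; rewrite mem_zsym; lia.
Qed.

Lemma core_coef0 n : (core n)`_0 = (-1) ^+ n * n`!%:R * n`!%:R.
Proof.
rewrite -horner_coef0 /core nodalE (big_nodes_rem _ _ Z0).
rewrite (prod_zsym (k := Z0)); last by lia.
by rewrite Z.sub_0_r Z.add_0_r Nat2Z.id.
Qed.

(** Up to the sign [(-1)^k], [Ccoef] is the ratio of the derivatives of the node polynomial at 0 and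
    at [k], both of which [prod_zsym] turns into factorials. *)
Lemma Ccoef_core n k : (Z.abs k <= Z.of_nat n)%Z ->
  Ccoef (Z.of_nat n) (Z.of_nat n) k * (nodal (rem (IZR k) (nodes n))).[IZR k]
  = (-1) ^+ Z.abs_nat k * (core n)`_0.
Proof.
move=> kn; rewrite nodalE big_nodes_rem prod_zsym // core_coef0 /Ccoef.
rewrite Nat2Z.id !factE !INRE !RmultE RdivE.
set a := Z.to_nat (_ + k); set b := Z.to_nat (_ - k).
(* Here [b + n = 2 n - k] has the parity of [k]. *)
have -> : (-1) ^+ Z.abs_nat k = (-1) ^+ (b + n) :> R.
  by rewrite -signr_odd -[RHS]signr_odd; congr (_ ^+ _); rewrite /b; lia.
have a0 : a`!%:R != 0 :> R by rewrite pnatr_eq0 -lt0n fact_gt0.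
have b0 : b`!%:R != 0 :> R by rewrite pnatr_eq0 -lt0n fact_gt0.
rewrite exprD; set u := (-1) ^+ b; set v := (-1) ^+ n.
have vv : v * v = 1 by rewrite -expr2 sqrr_sign.
have -> : u * v * (v * n`!%:R * n`!%:R) = v * v * (u * n`!%:R * n`!%:R) by ring.
by rewrite vv; field; rewrite b0 a0.
Qed.

Lemma sumZ_symE n f :
  sumZ (- Z.of_nat n) (Z.of_nat n) f = \sum_(k <- zsym n) f k.
Proof. by rewrite sumZE; congr (\sum_(k <- zseq _ _) _); lia. Qed.

Lemma sumZ_exceptE n k f :
  sumZ_except (- Z.of_nat n) (Z.of_nat n) k f = \sum_(l <- zsym n | l != k) f l.
Proof.
rewrite /sumZ_except sumZ_symE [RHS]big_mkcond; apply: eq_bigr => l _.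
by rewrite eqZE; case: (l =? k)%Z.
Qed.

Lemma zetaE n k :
  zeta (Z.of_nat n) (Z.of_nat n) k =
  (nodal (rem (IZR k) (nodes n)))^`().[IZR k] / (nodal (rem (IZR k) (nodes n))).[IZR k].
Proof.
rewrite nodal_log_deriv ?rem_notin ?uniq_nodes // big_nodes_rem /zeta sumZ_exceptE.
by apply: eq_bigr => l _; rewrite RdivE minus_IZR mul1r.
Qed.

(** * Closed forms of the weights *)

Section Weights.
Variables n m : nat.
Hypothesis mn : (m <= n)%N.

Let s := nodes n.
Let t := nodes m.
(** The even factor [G] of [Omega]. *)
Definition core_prod : {poly R} := core n * core m.

Lemma sub_nodes : {subset nodes m <= nodes n}.
Proof.
move=> y /mapP[k km ->]; rewrite mem_nodes.
by move: km; rewrite mem_zsym; lia.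
Qed.

Lemma core_prod_coef1 : core_prod`_1 = 0.
Proof.
by rewrite coefM !big_ord_recl big_ord0 /= !core_coef1 mulr0 mul0r !addr0.
Qed.

Lemma core_prod_coef0 : core_prod`_0 = (core n)`_0 * (core m)`_0.
Proof. by rewrite coef0M. Qed.

Lemma core_prod_coef0_neq0 : core_prod`_0 != 0.
Proof. by rewrite core_prod_coef0 mulf_neq0 ?core_coef0_neq0. Qed.

Lemma core_prod_coef2 : core_prod`_2 * 6 = - core_prod`_0 *
  (\sum_(k <- zsym n | k != Z0) (3 / IZR k ^+ 2)
   + \sum_(k <- zsym m | k != Z0) (3 / IZR k ^+ 2)).
Proof.
rewrite coefM !big_ord_recl big_ord0 /= /bump /= !addr0 !core_coef1 core_prod_coef0.
rewrite mul0r add0r mulrDl -[_ * 6]mulrA core_coef2.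
by rewrite [X in _ + X]mulrAC core_coef2; ring.
Qed.

(** [6 * p`_3] is the third derivative of [p] at [0]. *)
Definition cweight (k : Z) : R := 6 * (hermite_val s t (IZR k))`_3.
Definition bweight (k : Z) : R := 6 * (hermite_der s t (IZR k))`_3.

(** The third coefficient changes sign under reflection. For [bweight] the sign in [hermite_der_opp]
    compensates, which leaves an even weight. *)
Lemma cweight_opp k : (Z.abs k <= Z.of_nat n)%Z -> cweight (- k) = - cweight k.
Proof.
move=> kn; rewrite /cweight opp_IZR RoppE.
have := congr1 (fun p : {poly R} => p`_3)
  (hermite_val_opp (uniq_nodes n) (uniq_nodes m) sub_nodes (@nodesN n) (@nodesN m)
    (_ : IZR k \in nodes n)).
rewrite mem_nodes => <-; last by lia.
by rewrite coef_comp_opp -signr_odd expr1 mulN1r mulrN opprK.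
Qed.

Lemma bweight_opp k : (Z.abs k <= Z.of_nat m)%Z -> bweight (- k) = bweight k.
Proof.
move=> km; rewrite /bweight opp_IZR RoppE; congr (_ * _); apply: oppr_inj.
have := congr1 (fun p : {poly R} => p`_3)
  (hermite_der_opp (uniq_nodes n) (uniq_nodes m) sub_nodes (@nodesN n) (@nodesN m)
    (_ : IZR k \in nodes m)).
rewrite mem_nodes coefN => <-; last by lia.
by rewrite coef_comp_opp -signr_odd expr1 mulN1r.
Qed.

Lemma cweight0 : cweight 0 = 0.
Proof.
have := cweight_opp (_ : Z.abs 0 <= Z.of_nat n)%Z => /(_ ltac:(lia)) /= /eqP.
by rewrite -addr_eq0 -mulr2n mulrn_eq0 => /eqP.
Qed.

Lemma hermite_quot0 : hermite_quot s t 0 = core_prod.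
Proof. by []. Qed.

(** The two signs [(-1)^k] from [Ccoef_core] cancel. *)
Lemma hermite_quot_Ccoef k : (Z.abs k <= Z.of_nat m)%Z ->
  core_prod`_0 / (hermite_quot s t (IZR k)).[IZR k] =
  Ccoef (Z.of_nat n) (Z.of_nat n) k * Ccoef (Z.of_nat m) (Z.of_nat m) k.
Proof.
move=> km; have Q0 : (hermite_quot s t (IZR k)).[IZR k] != 0.
  by apply: hermite_quot_neq0; apply: uniq_nodes.
apply: (canLR (mulfK Q0)); rewrite /hermite_quot hornerM mulrACA.
rewrite (Ccoef_core km) (@Ccoef_core n k); last by lia.
by rewrite mulrACA -expr2 sqrr_sign mul1r core_prod_coef0.
Qed.

Lemma hermite_quot_double k : (Z.abs k <= Z.of_nat m)%Z ->
  ('X - (IZR k)%:P) ^+ 2 * hermite_quot s t (IZR k) = 'X^2 * core_prod.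
Proof.
move=> km; rewrite /hermite_quot expr2 mulrACA -!nodal_rem ?mem_nodes ?nodal_nodes.
- by rewrite mulrACA -expr2.
- lia.
- lia.
Qed.

Lemma coef_XsubCM (c : R) (p : {poly R}) i :
  (('X - c%:P) * p)`_i = (if i is j.+1 then p`_j else 0) - c * p`_i.
Proof. by rewrite mulrBl coefB coefXM coefCM; case: i. Qed.

(** Divide [X^2 G] by [(X - k)^2] as power series: [1 / (X - k)^2] begins with
    [1 / k^2 + 2 X / k^3], and [G] has no linear term. *)
Lemma hermite_quot_coef k : (Z.abs k <= Z.of_nat m)%Z -> k <> Z0 ->
  (hermite_quot s t (IZR k))`_2 = core_prod`_0 / IZR k ^+ 2 /\
  (hermite_quot s t (IZR k))`_3 = core_prod`_0 * 2 / IZR k ^+ 3.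
Proof.
move=> km k0; have z0 : IZR k != 0 by apply/eqP => /IZR_inj.
have E i : (('X - (IZR k)%:P) ^+ 2 * hermite_quot s t (IZR k))`_i = ('X^2 *
  core_prod)`_i.
  by rewrite hermite_quot_double.
move: (E 0%N) (E 1%N) (E 2%N) (E 3%N).
rewrite !expr2 -!mulrA !coef_XsubCM !coefXM /= core_prod_coef1.
move: (hermite_quot s t _)`_0 (hermite_quot s t _)`_1 (hermite_quot s t _)`_2
  (hermite_quot s t _)`_3 => q0 q1 q2 q3.
move=> e0 e1 e2 e3.
have Q0 : q0 = 0.
  apply/eqP; have : IZR k * IZR k * q0 = 0 by rewrite -[RHS]e0; ring.
  by move/eqP; rewrite !mulf_eq0 (negbTE z0).
have Q1 : q1 = 0.
  apply/eqP; have : IZR k * IZR k * q1 = 0 by rewrite -[RHS]e1 Q0; ring.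
  by move/eqP; rewrite !mulf_eq0 (negbTE z0).
have Q2 : q2 = core_prod`_0 / IZR k ^+ 2.
  by rewrite -e2 Q0 Q1; field.
split; first exact: Q2.
have -> : core_prod`_0 * (2 / IZR k ^+ 3) = 2 * (q2 / IZR k) by rewrite Q2; field.
have : IZR k * q3 = 2 * q2.
  apply: (mulfI z0); apply/eqP; rewrite -subr_eq0; apply/eqP.
  by rewrite -e3 Q1; ring.
by move=> H; apply: (mulfI z0); rewrite H; field.
Qed.

(** With [q2], [q3] the coefficients just found, that of [(X - k) Q] is
    [q2 - k q3 = - G(0) / k^2]. *)
Lemma bweightE k : (Z.abs k <= Z.of_nat m)%Z -> k <> Z0 ->
  bweight k = - (6 / IZR k ^+ 2) * Ccoef (Z.of_nat n) (Z.of_nat n) k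
              * Ccoef (Z.of_nat m) (Z.of_nat m) k.
Proof.
move=> km k0; have z0 : IZR k != 0 by apply/eqP => /IZR_inj.
rewrite -mulrA -hermite_quot_Ccoef // /bweight hermite_derE coef_affineM.
have [-> ->] := hermite_quot_coef km k0.
have Q0 : (hermite_quot s t (IZR k)).[IZR k] != 0 by apply: hermite_quot_neq0;
  apply: uniq_nodes.
by field; rewrite Q0 z0.
Qed.

(** At node 0 the quotient is [G] itself, and the third coefficient of [X G / G(0)] is
    [G_2 / G(0)]. *)
Lemma bweight0 : bweight 0 =
  - \sum_(k <- zsym n | k != Z0) (3 / IZR k ^+ 2)
  - \sum_(k <- zsym m | k != Z0) (3 / IZR k ^+ 2).
Proof.
rewrite /bweight hermite_derE coef_affineM hermite_quot0 /= mulr0 subr0 mul0r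
  add0r mul1r.
rewrite horner_coef0 mulrCA [6 * _]mulrC core_prod_coef2 mulNr mulrN mulrA.
by rewrite mulVf ?core_prod_coef0_neq0 // mul1r opprD.
Qed.

(** With slope [sigma], the sum of the two [zeta], the third coefficient before normalization is [(1
    + sigma k) q3 - sigma q2 = G(0) (2 + k sigma) / k^3]. *)
Lemma cweightE k : (Z.abs k <= Z.of_nat m)%Z -> k <> Z0 ->
  cweight k =
  6 * (2 + IZR k * (zeta (Z.of_nat n) (Z.of_nat n) k
                    + zeta (Z.of_nat m) (Z.of_nat m) k)) / IZR k ^+ 3
  * Ccoef (Z.of_nat n) (Z.of_nat n) k * Ccoef (Z.of_nat m) (Z.of_nat m) k.
Proof.
move=> km k0; have z0 : IZR k != 0 by apply/eqP => /IZR_inj.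
have kt : IZR k \in t by rewrite mem_nodes; lia.
rewrite -[RHS]mulrA -hermite_quot_Ccoef // !zetaE /cweight hermite_valE
  coef_affineM /hermite_slope kt.
have s0 := nodal_neq0 (rem_notin (IZR k) (uniq_nodes n)).
have t0 := nodal_neq0 (rem_notin (IZR k) (uniq_nodes m)).
have -> : (hermite_quot s t (IZR k))^`().[IZR k] / (hermite_quot s t (IZR k)).[IZR k] =
  (nodal (rem (IZR k) s))^`().[IZR k] / (nodal (rem (IZR k) s)).[IZR k] +
  (nodal (rem (IZR k) t))^`().[IZR k] / (nodal (rem (IZR k) t)).[IZR k].
  rewrite /hermite_quot derivM hornerD !hornerM; field.
  by rewrite s0 t0.
have [-> ->] := hermite_quot_coef km k0.
have Q0 : (hermite_quot s t (IZR k)).[IZR k] != 0 by apply: hermite_quot_neq0;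
  apply: uniq_nodes.
by rewrite /s /t; field; rewrite Q0 z0 t0 s0.
Qed.

(** The outermost node now lies in [s] only, so it is a simple root of [Omega]: [(X - n) Q = X^2 G],
    the slope is 0 and [Q_3 = - G(0) / n^2]. *)
Lemma cweight_last : n = m.+1 ->
  cweight (Z.of_nat n) =
  6 / IZR (Z.of_nat n) ^+ 3 * Ccoef (Z.of_nat n) (Z.of_nat n) (Z.of_nat n)
  * Ccoef (Z.of_nat m) (Z.of_nat n) (Z.of_nat n).
Proof.
move=> E; set z := IZR _.
have zE : z = n%:R by rewrite /z -INR_IZR_INZ INRE.
have z0 : z != 0 by rewrite zE pnatr_eq0 E.
have zt : z \notin t by rewrite mem_nodes; lia.
have zs : z \in s by rewrite mem_nodes; lia.
have HQ : ('X - z%:P) * hermite_quot s t z = 'X^2 * core_prod.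
  by rewrite /hermite_quot (rem_id zt) mulrA -nodal_rem // !nodal_nodes mulrACA -expr2.
have e i : (('X - z%:P) * hermite_quot s t z)`_i = ('X^2 * core_prod)`_i by rewrite HQ.
move: (e 0%N) (e 1%N) (e 2%N) (e 3%N).
rewrite !expr2 -!mulrA !coef_XsubCM !coefXM /= core_prod_coef1 => e0 e1 e2 e3.
have Q0 : (hermite_quot s t z)`_0 = 0.
  by apply: (mulfI z0); apply: oppr_inj; rewrite mulr0 oppr0 -[RHS]e0 sub0r.
have Q1 : (hermite_quot s t z)`_1 = 0.
  by apply: (mulfI z0); apply: oppr_inj; rewrite mulr0 oppr0 -[RHS]e1 Q0 sub0r.
have Q2 : (hermite_quot s t z)`_2 = - core_prod`_0 / z.
  by rewrite -e2 Q1; field.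
have Q3 : (hermite_quot s t z)`_3 = - core_prod`_0 / z ^+ 2.
  apply: (mulfI z0); rewrite -[LHS]opprK -[- (z * _)]sub0r.
  have -> : 0 - z * (hermite_quot s t z)`_3 = - (hermite_quot s t z)`_2.
    by apply/eqP; rewrite -subr_eq0; apply/eqP; rewrite -[RHS]e3; ring.
  by rewrite Q2; field.
(* Since [n = m + 1] comes right after the list [zsym m], the second factor is
   [(2 m + 1)! = (n + m)!]. *)
have V : (hermite_quot s t z).[z] = (n + n)`!%:R * (n + m)`!%:R.
  rewrite /hermite_quot (rem_id zt) hornerM !nodalE big_nodes_rem prod_zsym;
    last by lia.
  rewrite Z.sub_diag mul1r mulr1; congr (_`!%:R * _); first by lia.
  rewrite big_map; have := prod_zseq_below (- Z.of_nat m) (m + m).+1.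
  have -> : (- Z.of_nat m + Z.of_nat (m + m).+1 = Z.of_nat n)%Z by lia.
  by rewrite -/(zsym m) => ->; rewrite E addSn.
rewrite /cweight hermite_valE coef_affineM /hermite_slope (negbTE zt) oppr0
  !mul0r subr0 mul1r addr0.
rewrite V Q3 core_prod_coef0 !core_coef0 /Ccoef !Nat2Z.id Z.sub_diag.
rewrite !factE !INRE !RmultE !RdivE -/z zE ?RinvE.
have -> : Z.to_nat (Z.of_nat n + Z.of_nat n) = (n + n)%N by lia.
have -> : Z.to_nat (Z.of_nat m + Z.of_nat n) = (n + m)%N by lia.
rewrite /= fact0.
have F j : j`!%:R != 0 :> R by rewrite pnatr_eq0 -lt0n fact_gt0.
(* This identity accounts for the [n^3] of the stated formula in place of [n^2]. *)
have nE : n`!%:R = n%:R * m`!%:R :> R by rewrite E factS natrM.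
have sg : (-1) ^+ n * (-1) ^+ m = -1 :> R.
  by rewrite E exprS -mulrA -expr2 sqrr_sign mulr1.
have -> : (-1) ^+ n * n`!%:R * n`!%:R * ((-1) ^+ m * m`!%:R * m`!%:R) =
  - (n`!%:R * n`!%:R * (m`!%:R * m`!%:R)) :> R.
  by rewrite mulrACA [X in X * _]mulrACA sg; ring.
have nz : n%:R != 0 :> R by rewrite -zE.
have F1 := F (n + n)%N; have F2 := F (n + m)%N; move: F1 F2 nz.
rewrite nE; move: (n%:R) (m`!%:R) (_`!%:R) (_`!%:R) => a b c d c0 d0 a0.
by field; rewrite a0 c0 d0.
Qed.

End Weights.

(** * The operator as a functional on polynomials *)

Lemma size_monic_sub (p q : {poly R}) : p \is monic -> q \is monic ->
  size p = size q -> (size (p - q)%R < size p)%N.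
Proof.
move=> pm qm pq; have p0 : (0 < size p)%N by rewrite size_poly_gt0 monic_neq0.
rewrite -(prednK p0) ltnS; apply/leq_sizeP => j; rewrite coefB leq_eqVlt.
case/orP => [/eqP <-|pj].
  have /monicP := pm; have /monicP := qm; rewrite !lead_coefE -pq => -> ->.
  by rewrite subrr.
by rewrite !nth_default ?subrr // -?pq -(prednK p0).
Qed.

Lemma sum_zsym_odd l (f : Z -> R) :
  (forall k, (Z.abs k <= Z.of_nat l)%Z -> f (- k)%Z = - f k) ->
  \sum_(k <- zsym l) f k = 0.
Proof.
move=> fN; set S := LHS; have SN : S = - S.
  rewrite -sumrN /S -sum_zsym_opp big_seq [RHS]big_seq; apply: eq_bigr => k.
  by rewrite mem_zsym => kl; apply: fN; lia.
by move/eqP: SN; rewrite -addr_eq0 -mulr2n mulrn_eq0 => /eqP.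
Qed.

Lemma natr_IZR l : l%:R = IZR (Z.of_nat l) :> R.
Proof. by rewrite -INRE INR_IZR_INZ. Qed.

(** Abel summation, passing from cell weights to node weights; for [acoef] both boundary terms
    vanish. *)
Lemma sum_by_parts (a f : Z -> R) lo l :
  \sum_(k <- zseq lo l) a k * (f (k + 1)%Z - f k) =
  \sum_(k <- zseq lo l.+1) (a (k - 1)%Z - a k) * f k
  - a (lo - 1)%Z * f lo + a (lo + Z.of_nat l)%Z * f (lo + Z.of_nat l)%Z.
Proof.
elim: l => [|l IH].
  by rewrite big_nil zseq_cons big_cons big_nil Z.add_0_r; ring.
rewrite zseq_rcons -cats1 big_cat big_seq1 IH [in RHS]zseq_rcons -cats1 big_cat
  big_seq1 /=.
have -> : (lo + Z.of_nat l.+1 = lo + Z.of_nat l + 1)%Z by lia.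
by rewrite Z.add_simpl_r; ring.
Qed.

Section Functional.
Variables n m : nat.
Implicit Types (a b : Z -> R) (W : {poly R}).

Definition stencil a b W : R :=
  \sum_(k <- zseq (- Z.of_nat n) (n + n)) a k * (W.[IZR (k + 1)] - W.[IZR k])
  + \sum_(k <- zsym m) b k * W^`().[IZR k].

Lemma stencilD a b : {morph stencil a b : V W / V + W}.
Proof.
move=> V W; rewrite /stencil addrACA -!big_split /=; congr (_ + _).
  by apply: eq_bigr => k _; rewrite !hornerD; ring.
by apply: eq_bigr => k _; rewrite derivD hornerD; ring.
Qed.

Lemma stencilZ a b c W : stencil a b (c *: W) = c * stencil a b W.
Proof.
rewrite /stencil mulrDr !mulr_sumr; congr (_ + _).
  by apply: eq_bigr => k _; rewrite !hornerZ; ring.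
by apply: eq_bigr => k _; rewrite derivZ hornerZ; ring.
Qed.

Lemma stencilC a b c : stencil a b c%:P = 0.
Proof.
by rewrite /stencil !big1 ?addr0 // => k _; rewrite ?derivC !hornerC ?subrr mulr0.
Qed.

Lemma stencil_coef a b W : stencil a b W = \sum_(i < size W) W`_i * stencil a b 'X^i.
Proof.
rewrite -[in LHS](coefK W) poly_def (big_morph (stencil a b) (stencilD a b)
  (stencilC a b 0)).
by apply: eq_bigr => i _; rewrite stencilZ.
Qed.

(** An antiderivative of [x ^ d] is [x ^ (d + 1) / (d + 1)]. *)
Lemma moment_stencil a b d :
  moment (Z.of_nat n) (Z.of_nat m) a b d * d.+1%:R = stencil a b 'X^(d.+1).
Proof.
rewrite /moment sumZ_symE sumZE /stencil mulrDl !mulr_suml; congr (_ + _).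
  have -> : Z.to_nat (Z.of_nat n - 1 - - Z.of_nat n + 1) = (n + n)%N by lia.
  apply: eq_bigr => k _; rewrite !RmultE RdivE RminusE !RpowE INRE !hornerXn.
  by field; rewrite nat1r pnatr_eq0.
apply: eq_bigr => k _; rewrite derivXn RmultE RpowE hornerMn hornerXn.
by rewrite -mulrA mulr_natr.
Qed.

(** Moments up to [M] fix the functional on powers up to [M + 1], since passing to antiderivatives
    raises the degree by one and constants are killed. *)
Lemma stencil_determined a b a' b' M W :
  (forall d, (d <= M)%N -> moment (Z.of_nat n) (Z.of_nat m) a' b' d
                        = moment (Z.of_nat n) (Z.of_nat m) a b d) ->
  (size W <= M.+2)%N -> stencil a' b' W = stencil a b W.
Proof.
move=> eqm sW; rewrite stencil_coef [RHS]stencil_coef;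
  apply: eq_bigr => -[[|i] /= iW] _.
  by rewrite !(stencilC _ _ 1).
by rewrite -!moment_stencil eqm //; have := leq_trans iW sW; rewrite !ltnS.
Qed.

(** The solution of [acoef (k - 1) - acoef k = cweight k] vanishing at [n]; the
    maximum makes it symmetric under [k -> -1 - k]. *)
Definition acoef (k : Z) : R :=
  let j := Z.max k (- 1 - k) in
  \sum_(l <- zseq (j + 1) (Z.to_nat (Z.of_nat n - j))) cweight n m l.

Lemma acoef_sym k : acoef (- 1 - k) = acoef k.
Proof. by rewrite /acoef; congr (\sum_(l <- zseq _ _) _); lia. Qed.

Lemma acoef_last : acoef (Z.of_nat n) = 0.
Proof.
rewrite /acoef; have -> : (Z.max (Z.of_nat n) (-1 - Z.of_nat n) = Z.of_nat n)%Z by lia.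
by rewrite Z.sub_diag big_nil.
Qed.

Lemma acoef_pred k : (0 < k <= Z.of_nat n)%Z ->
  acoef (k - 1) - acoef k = cweight n m k.
Proof.
move=> kn; rewrite /acoef.
have -> : (Z.max (k - 1) (-1 - (k - 1)) = k - 1)%Z by lia.
have -> : (Z.max k (-1 - k) = k)%Z by lia.
have -> : Z.to_nat (Z.of_nat n - (k - 1)) = (Z.to_nat (Z.of_nat n - k)).+1 by lia.
by rewrite Z.sub_add zseq_cons big_cons addrK.
Qed.

Hypothesis mn : (m <= n)%N.
Let s := nodes n.
Let t := nodes m.

(** Negative [k] reduces to positive [k], because [acoef] is symmetric and [cweight] is odd; at
    [k = 0] both sides vanish. *)
Lemma acoef_diff k : (Z.abs k <= Z.of_nat n)%Z ->
  acoef (k - 1) - acoef k = cweight n m k.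
Proof.
move=> kn; have [k0|[<-|k0]] := Z.lt_total 0 k.
- by apply: acoef_pred; lia.
- by rewrite -(acoef_sym 0) subrr cweight0.
- rewrite -(acoef_sym k) -(acoef_sym (k - 1)) -[RHS]opprK -cweight_opp //.
  rewrite -acoef_pred ?opprB; last by lia.
  by congr (acoef _ - acoef _); lia.
Qed.

Lemma stencil_weights W : stencil acoef (bweight n m) W =
  \sum_(k <- zsym n) cweight n m k * W.[IZR k] +
  \sum_(k <- zsym m) bweight n m k * W^`().[IZR k].
Proof.
rewrite /stencil (sum_by_parts acoef (fun k => W.[IZR k])); congr (_ + _).
have -> : (- Z.of_nat n + Z.of_nat (n + n) = Z.of_nat n)%Z by lia.
rewrite acoef_last mul0r addr0.
have -> : acoef (- Z.of_nat n - 1) = 0.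
  by rewrite -acoef_last -acoef_sym; congr acoef; lia.
rewrite mul0r subr0 -/(zsym n) big_seq [RHS]big_seq.
by apply: eq_bigr => k; rewrite mem_zsym => kn; rewrite acoef_diff //; lia.
Qed.

Lemma stencil_hermite W : (size W <= (n + n + (m + m)).+2)%N ->
  stencil acoef (bweight n m) W = 6 * W`_3.
Proof.
move=> sW; rewrite stencil_weights.
have sW' : (size W <= size s + size t)%N.
  by rewrite /s /t !size_nodes addnS addSn.
have := hermite_interpolation (uniq_nodes n) (uniq_nodes m) (sub_nodes mn) sW'.
move/(congr1 (fun p : {poly R} => 6 * p`_3)) => <-.
rewrite /hermite !big_map coefD !coef_sum mulrDr !mulr_sumr; congr (_ + _).
  by apply: eq_bigr => k _; rewrite coefZ /cweight; ring.
by apply: eq_bigr => k _; rewrite coefZ /bweight; ring.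
Qed.

Definition nodal_prod : {poly R} := nodal s * nodal t.

Lemma nodal2E : nodal_prod = 'X^2 * core_prod n m.
Proof. by rewrite /nodal_prod /s /t !nodal_nodes mulrACA -expr2. Qed.

(** [Omega] vanishes on [s] and doubly on [t], which is all the data that the functional sees. *)
Lemma stencil_nodal_prod p : stencil acoef (bweight n m) (nodal_prod * p) = 0.
Proof.
rewrite /nodal_prod stencil_weights big_seq big1 ?add0r; last first.
  move=> k kn; rewrite !hornerM (@nodal_eq0 _ s) ?mul0r ?mulr0 //.
  by apply: map_f.
rewrite big_seq big1 // => k km.
have kt : IZR k \in t by apply: map_f.
have ks := sub_nodes mn kt.
rewrite !derivM hornerD !hornerM (nodal_eq0 ks) !mul0r addr0 hornerD !hornerM.
by rewrite (nodal_eq0 ks) (nodal_eq0 kt) !(mulr0, mul0r, addr0).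
Qed.

Lemma size_nodal_prod : size nodal_prod = (n + n + (m + m)).+3.
Proof.
rewrite size_monicM ?nodal_monic ?monic_neq0 ?nodal_monic //.
by rewrite !size_nodal !size_nodes; lia.
Qed.

Lemma nodal_prod_monic : nodal_prod \is monic.
Proof. by rewrite monicMr nodal_monic. Qed.

(** One degree is gained: subtracting a multiple of [Omega] lowers the degree and leaves the third
    coefficient unchanged, since that of [Omega] is [G_1 = 0]. *)
Lemma stencil_hermiteS W : (size W <= (n + n + (m + m)).+3)%N ->
  stencil acoef (bweight n m) W = 6 * W`_3.
Proof.
set N := (n + n + (m + m)).+2 => sW.
have WE : W = nodal_prod * (W`_N)%:P + (W - W`_N *: nodal_prod).
  by rewrite mulrC mul_polyC addrC subrK.
rewrite [in LHS]WE stencilD stencil_nodal_prod add0r stencil_hermite; last first.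
  apply/leq_sizeP => j; rewrite leq_eqVlt coefB coefZ => /orP[/eqP <-|Nj].
    have /monicP := nodal_prod_monic; rewrite lead_coefE size_nodal_prod => ->.
    by rewrite mulr1 subrr.
  have Wj : W`_j = 0 by apply: nth_default; exact: leq_trans sW Nj.
  have Oj : nodal_prod`_j = 0 by apply: nth_default; rewrite size_nodal_prod.
  by rewrite Wj Oj mulr0 subrr.
by rewrite coefB coefZ nodal2E coefXnM /= core_prod_coef1 mulr0 subr0.
Qed.

(** Compare with the monic [X Omega] of the same degree, which is killed and whose third coefficient
    is [G(0)]. *)
Lemma stencil_top : (0 < n)%N ->
  stencil acoef (bweight n m) 'X^((n + n + (m + m)).+3) = - 6 * (core_prod n m)`_0.
Proof.
move=> n0; set N := (n + n + (m + m)).+2.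
have XN : nodal_prod * 'X \is monic by rewrite monicMr ?nodal_prod_monic ?monicX.
have sN : size (nodal_prod * 'X) = size ('X^(N.+1) : {poly R}).
  by rewrite size_mulX ?monic_neq0 ?nodal_prod_monic // size_nodal_prod size_polyXn.
rewrite -(subrK (nodal_prod * 'X) 'X^(N.+1)) stencilD stencil_nodal_prod addr0
  stencil_hermiteS.
  rewrite coefB coefXn coefMX nodal2E coefXnM /=.
  have -> : (3 == N.+1)%N = false by rewrite /N; lia.
  by rewrite sub0r mulrN mulNr.
by rewrite -ltnS; apply: leq_trans (size_monic_sub _ _ _) _;
  rewrite ?monicXn ?size_polyXn ?sN ?size_polyXn.
Qed.

(** An odd weight meets the even values [W(k)], an even weight the odd values [W'(k)]. *)
Lemma stencil_even d : ~~ odd d -> stencil acoef (bweight n m) 'X^d = 0.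
Proof.
move=> de; rewrite stencil_weights !sum_zsym_odd ?addr0 // => k kl.
- rewrite bweight_opp // derivXn !hornerMn !hornerXn opp_IZR RoppE.
  case: d de => [|d] /=; first by rewrite !mulr0n mulr0 oppr0.
  by rewrite negbK => dd; rewrite exprNn -signr_odd dd mulN1r mulNrn mulrN.
- rewrite cweight_opp // !hornerXn opp_IZR RoppE exprNn -signr_odd (negbTE de).
  by rewrite mul1r mulNr.
Qed.

(** With [P = 2 (n + m)], moments up to [P + 1] come from [stencil_hermiteS], moment [P + 2] from
    [stencil_top], and moment [P + 3] vanishes because [P + 4] is even. *)
Lemma acoef_bweight_order_accurate : (0 < n)%N ->
  order_accurate (Dxx (Z.of_nat n) (Z.of_nat m) acoef (bweight n m)) (n + n + (m + m)).
Proof.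
move=> n0; set P := (n + n + (m + m))%N.
have dS d : d.+1%:R != 0 :> R by rewrite pnatr_eq0.
apply: moment_order_accurate.
- by apply/ssrnat.leP; rewrite /P; lia.
- move=> d /ssrnat.leP dP; apply: (mulIf (dS d));
  rewrite moment_stencil stencil_hermiteS; last first.
    by rewrite size_polyXn -/P; lia.
  rewrite coefXn; case: d dP => [|[|[|d]]] _ /=; rewrite ?mulr0 ?mul0r //.
  by rewrite -[IZR 2](natr_IZR 2); ring.
- move=> M0; have := stencil_top n0.
  have -> : (n + n + (m + m)).+3 = (P + 2)%N.+1 by rewrite /P; lia.
  rewrite -moment_stencil M0 mul0r => /esym/eqP.
  by rewrite mulf_eq0 oppr_eq0 pnatr_eq0 (negbTE (core_prod_coef0_neq0 n m)).
- apply: (mulIf (dS (P + 3)%N)); rewrite moment_stencil mul0r.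
  by apply: stencil_even; rewrite /P; lia.
Qed.

(** Hermite interpolants within the degree bound realize arbitrary data: step values isolate one
    [a k], a single unit derivative isolates one [b k]. *)
Lemma stencil_inj a b a' b' :
  (forall W, (size W <= (n + n + (m + m)).+2)%N -> stencil a' b' W = stencil a b W) ->
  (forall k, (- Z.of_nat n <= k <= Z.of_nat n - 1)%Z -> a' k = a k) /\
  (forall k, (- Z.of_nat m <= k <= Z.of_nat m)%Z -> b' k = b k).
Proof.
pose H u v := hermite s t u v.
have sH u v : (size (H u v) <= (n + n + (m + m)).+2)%N.
  apply: leq_trans (size_hermite (sub_nodes mn) u v) _.
  by rewrite /s /t !size_nodes; lia.
have us : uniq s := uniq_nodes n.
have ut : uniq t := uniq_nodes m.
have ts : {subset t <= s} := sub_nodes mn.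
have E u v a0 b0 : stencil a0 b0 (H u v) =
    \sum_(k <- zseq (- Z.of_nat n) (n + n)) a0 k * (u (IZR (k + 1)) - u (IZR k))
    + \sum_(k <- zsym m) b0 k * v (IZR k).
  rewrite /stencil; congr (_ + _); rewrite big_seq [RHS]big_seq; apply: eq_bigr => k.
    rewrite mem_zseq => kn; rewrite !hermite_horner //; rewrite /s mem_nodes; lia.
  by move=> km; rewrite hermite_deriv //; apply: map_f.
move=> eqf; split=> k kn.
(* Only the difference over the cell [k, k + 1] of this step is nonzero. *)
- pose st (y : R) : R := (IZR k < y)%R%:R.
  have := eqf (H st (fun=> 0)) (sH _ _); rewrite !E.
  have F (a0 b0 : Z -> R) :
    \sum_(j <- zseq (- Z.of_nat n) (n + n)) a0 j * (st (IZR (j + 1)) - st (IZR j))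
    + \sum_(j <- zsym m) b0 j * 0 = a0 k.
    rewrite [X in _ + X]big1 ?addr0; last by move=> j _; rewrite mulr0.
    rewrite (big_rem k) /=; last by rewrite mem_zseq; lia.
    rewrite big_seq big1 ?addr0 => [|j].
      have -> : st (IZR (k + 1)) = 1.
        by rewrite /st; have -> : (IZR k < IZR (k + 1))%R by apply/RltP/IZR_lt; lia.
      by rewrite /st ltxx subr0 mulr1.
    rewrite mem_rem_uniq ?uniq_zseq // inE eqZE => /andP[/negP jk _].
    have [kj|jk'] := Z.lt_ge_cases k j.
      have /RltP h1 := IZR_lt k j kj.
      have /RltP h2 : (IZR k < IZR (j + 1))%coqR by apply: IZR_lt; lia.
      by rewrite /st h1 h2 subrr mulr0.
    have /RleP h1 := IZR_le j k jk'.
    have /RleP h2 : (IZR (j + 1) <= IZR k)%coqR by apply: IZR_le; lia.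
    by rewrite /st !ltNge h1 h2 subrr mulr0.
  by rewrite !F.
- have := eqf (H (fun=> 0) (fun y => (y == IZR k)%:R)) (sH _ _); rewrite !E.
  have F (a0 b0 : Z -> R) :
    \sum_(j <- zseq (- Z.of_nat n) (n + n)) a0 j * (0 - 0)
    + \sum_(j <- zsym m) b0 j * (IZR j == IZR k)%:R = b0 k.
    rewrite big1 => [|j _]; last by rewrite subrr mulr0.
    rewrite add0r.
    have km : k \in zsym m by rewrite mem_zsym; lia.
    have : uniq (zsym m) := uniq_zseq _ _; move: (zsym m) km => r kr ur.
    rewrite (big_rem k) //= big_seq big1 ?addr0 => [|j]; first by rewrite eqxx mulr1.
    rewrite mem_rem_uniq // inE => /andP[/negbTE jk _].
    by rewrite (inj_eq IZR_inj) jk mulr0.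
  by rewrite !F.
Qed.

(** If [n = m + 1], the sum defining [acoef] has one more index, [l = n], whose weight
    [cweight_last] is the Kronecker term. *)
Lemma acoefE k : (n <= m.+1)%N -> (0 <= k <= Z.of_nat n - 1)%Z ->
  acoef k =
  (sumZ (k + 1) (Z.of_nat m) (fun l =>
     6 * (2 + IZR l * (zeta (Z.of_nat n) (Z.of_nat n) l
                       + zeta (Z.of_nat m) (Z.of_nat m) l)) / IZR l ^ 3
     * Ccoef (Z.of_nat n) (Z.of_nat n) l * Ccoef (Z.of_nat m) (Z.of_nat m) l)
   + (1 - kronecker (Z.of_nat n) (Z.of_nat m)) * (6 / IZR (Z.of_nat n) ^ 3)
     * Ccoef (Z.of_nat n) (Z.of_nat n) (Z.of_nat n)
     * Ccoef (Z.of_nat m) (Z.of_nat n) (Z.of_nat n))%coqR.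
Proof.
move=> nm kn; rewrite /acoef.
have -> : (Z.max k (-1 - k) = k)%Z by lia.
set f := (X in sumZ _ _ X); rewrite sumZE.
have fE j : (0 < j <= Z.of_nat m)%Z -> cweight n m j = f j.
  move=> jm; rewrite cweightE; [|exact: mn|lia|lia].
  by rewrite !natr_IZR /f RpowE.
have -> : Z.to_nat (Z.of_nat m - (k + 1) + 1) = Z.to_nat (Z.of_nat m - k) by lia.
have S : \sum_(l <- zseq (k + 1) (Z.to_nat (Z.of_nat m - k))) cweight n m l =
   \sum_(l <- zseq (k + 1) (Z.to_nat (Z.of_nat m - k))) f l.
  rewrite big_seq [RHS]big_seq; apply: eq_bigr => j; rewrite mem_zseq => jm.
  by apply: fE; lia.
have [nEm|nEm] := eqVneq n m.
  rewrite /kronecker nEm Z.eqb_refl; rewrite nEm in S.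
  rewrite S !RmultE RplusE RminusE subrr !mul0r addr0 //.
have nE : n = m.+1 by lia.
rewrite /kronecker; have -> : (Z.of_nat n =? Z.of_nat m)%Z = false by lia.
have -> : Z.to_nat (Z.of_nat n - k) = (Z.to_nat (Z.of_nat m - k)).+1 by lia.
rewrite zseq_rcons -cats1 big_cat big_seq1 S RplusE; congr (_ + _).
have -> : (k + 1 + Z.of_nat (Z.to_nat (Z.of_nat m - k)) = Z.of_nat n)%Z by lia.
rewrite cweight_last // !RmultE RminusE subr0 mul1r RpowE RdivE.
by rewrite [6](natr_IZR 6).
Qed.

Lemma bweight_stdlibE k : (- Z.of_nat m <= k <= Z.of_nat m)%Z -> k <> Z0 ->
  bweight n m k = (- (6 / IZR k ^ 2) * Ccoef (Z.of_nat n) (Z.of_nat n) k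
                   * Ccoef (Z.of_nat m) (Z.of_nat m) k)%coqR.
Proof.
move=> km k0; rewrite bweightE; [|exact: mn|lia|by[]].
by rewrite !natr_IZR RpowE.
Qed.

Lemma bweight0_stdlibE : bweight n m 0 =
  (- sumZ_except (- Z.of_nat n) (Z.of_nat n) 0 (fun k => 3 / IZR k ^ 2)
   - sumZ_except (- Z.of_nat m) (Z.of_nat m) 0 (fun k => 3 / IZR k ^ 2))%coqR.
Proof.
rewrite !sumZ_exceptE bweight0 RminusE RoppE.
by congr (- _ - _); apply: eq_bigr => k _; rewrite RdivE RpowE natr_IZR.
Qed.

End Functional.

End Algebra_of_stencils.

(** * Signs of the weights and assembly of the theorem *)

Lemma Ccoef_pos (n : nat) (k : Z) :
  0 < Ccoef (Z.of_nat n) (Z.of_nat n) k.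
Proof.
  unfold Ccoef. apply Rdiv_lt_0_compat; apply Rmult_lt_0_compat; apply INR_fact_lt_0.
Qed.

(** Strict positivity is asked of the first term only, because a [sumZ_except] has a zero term at
    the omitted index. *)
Lemma sumZ_pos (lo hi : Z) (f : Z -> R) :
  (lo <= hi)%Z -> 0 < f lo -> (forall k, (lo <= k <= hi)%Z -> 0 <= f k) ->
  0 < sumZ lo hi f.
Proof.
  intros Hlh Hlo Hf. unfold sumZ.
  replace (Z.to_nat (hi - lo + 1)) with (S (Z.to_nat (hi - lo))) by lia.
  simpl. rewrite Z.add_0_r. apply Rplus_lt_le_0_compat; trivial.
  assert (H : forall i, In i (seq 1 (Z.to_nat (hi - lo))) ->
    0 <= f (lo + Z.of_nat i)%Z).
  { intros i Hi. apply in_seq in Hi. apply Hf. lia. }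
  revert H. induction (seq 1 _) as [|i s IH]; simpl; intros H; [lra|].
  apply Rplus_le_le_0_compat; auto.
Qed.

Theorem theorem2p6 (q q' : Z)
  (hqq' : (Z.max 0 (q - 1) <= q' <= q)%Z) (hpos : (1 <= q + q')%Z) :
  exists a b : Z -> R,
    at_least_order_accurate (Dxx q q' a b) (2 * (q + q')) /\
    (forall a' b' : Z -> R,
        at_least_order_accurate (Dxx q q' a' b') (2 * (q + q')) ->
        (forall k : Z, (- q <= k <= q - 1)%Z -> a' k = a k) /\
        (forall k : Z, (- q' <= k <= q')%Z -> b' k = b k)) /\
    (forall nu : Z, (- q <= nu < 0)%Z -> a nu = a (-1 - nu)%Z) /\
    (forall nu : Z, (0 <= nu <= q - 1)%Z ->
        a nu =
          sumZ (nu + 1) q' (fun k =>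
            6 * (2 + IZR k * (zeta q q k + zeta q' q' k)) / IZR k ^ 3
            * Ccoef q q k * Ccoef q' q' k)
          + (1 - kronecker q q') * (6 / IZR q ^ 3)
            * Ccoef q q q * Ccoef q' q q) /\
    b 0%Z = - sumZ_except (- q) q 0 (fun k => 3 / IZR k ^ 2)
            - sumZ_except (- q') q' 0 (fun k => 3 / IZR k ^ 2) /\
    (forall nu : Z, (- q' <= nu <= q')%Z -> nu <> 0%Z ->
        b nu = - (6 / IZR nu ^ 2) * Ccoef q q nu * Ccoef q' q' nu) /\
    sumZ (- q') q' b < 0.
Proof.
  destruct (Z_of_nat_complete q) as [n ->]; [lia|].
  destruct (Z_of_nat_complete q') as [m ->]; [lia|].
  assert (mn : is_true (ssrnat.leq m n)) by (apply (ssrbool.introT ssrnat.leP); lia).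
  assert (nm : is_true (ssrnat.leq n (S m)))
    by (apply (ssrbool.introT ssrnat.leP); lia).
  assert (n0 : is_true (ssrnat.leq 1 n)) by (apply (ssrbool.introT ssrnat.leP); lia).
  pose proof (Algebra_of_stencils.acoef_bweight_order_accurate mn n0) as Hacc.
  set (a := Algebra_of_stencils.acoef n m) in *.
  set (b := Algebra_of_stencils.bweight n m) in *.
  assert (Hb0 := Algebra_of_stencils.bweight0_stdlibE n m). fold b in Hb0.
  assert (Hb : forall nu : Z, (- Z.of_nat m <= nu <= Z.of_nat m)%Z -> nu <> 0%Z ->
    b nu = - (6 / IZR nu ^ 2) * Ccoef (Z.of_nat n) (Z.of_nat n) nu
           * Ccoef (Z.of_nat m) (Z.of_nat m) nu).
  { intros nu. apply (Algebra_of_stencils.bweight_stdlibE mn). }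
  exists a, b. split; [|split; [|split; [|split; [|split; [|split]]]]].
  - eexists. split; [|exact Hacc]. change ssrnat.addn with Nat.add. lia.
  (* Accuracy forces the moments up to [2 (q + q')] of both operators to be those of the second
     derivative, so the two functionals agree in degree less than [N]. *)
  - intros a' b' (P & HP & HaccP).
    apply (Algebra_of_stencils.stencil_inj mn). intros W HW.
    refine (Algebra_of_stencils.stencil_determined _ HW).
    intros d Hd. apply (ssrbool.elimT ssrnat.leP) in Hd.
    change ssrnat.addn with Nat.add in *.
    rewrite (order_accurate_moment _ _ a' b' P) by (trivial; lia).
    symmetry. apply (order_accurate_moment _ _ _ _ _ d Hacc). lia.
  - intros nu _. symmetry. apply Algebra_of_stencils.acoef_sym.
  - intros nu Hnu. exact (Algebra_of_stencils.acoefE mn nm Hnu).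
  - exact Hb0.
  - exact Hb.
  - assert (Hsq : forall k, k <> 0%Z -> 0 < IZR k ^ 2).
    { intros k Hk. apply pow2_gt_0. intros E. now apply Hk, eq_IZR. }
    assert (Hex : forall l, (0 < l)%nat ->
      0 < sumZ_except (- Z.of_nat l) (Z.of_nat l) 0 (fun k => 3 / IZR k ^ 2)).
    { intros l Hl. apply sumZ_pos; [lia| |].
      - destruct (Z.eqb_spec (- Z.of_nat l) 0) as [E|E]; [lia|].
        apply Rdiv_lt_0_compat; [lra | now apply Hsq].
      - intros k _. destruct (Z.eqb_spec k 0) as [E|E]; [lra|].
        left. apply Rdiv_lt_0_compat; [lra | now apply Hsq]. }
    (* Each single [b nu] is negative; the factor [-1] is placed so that [sumZ_scal] applies. *)
    assert (Hneg : forall nu, (- Z.of_nat m <= nu <= Z.of_nat m)%Z -> 0 < -1 * b nu).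
    { intros nu Hnu. destruct (Z.eq_dec nu 0) as [->|Hnu0].
      - rewrite Hb0. pose proof (Hex n ltac:(lia)).
        assert (0 <= sumZ_except (- Z.of_nat m) (Z.of_nat m) 0
                       (fun k => 3 / IZR k ^ 2)).
        (* For [m = 0] the only index is the omitted one and the sum is 0. *)
        { destruct (Nat.eq_0_gt_0_cases m) as [->|Hm]; [|left; now apply Hex].
          unfold sumZ_except, sumZ. simpl. lra. }
        lra.
      - rewrite Hb by trivial.
        replace (-1 * _) with (6 / IZR nu ^ 2 * Ccoef (Z.of_nat n) (Z.of_nat n) nu
          * Ccoef (Z.of_nat m) (Z.of_nat m) nu) by ring.
        apply Rmult_lt_0_compat; [|apply Ccoef_pos].
        apply Rmult_lt_0_compat; [|apply Ccoef_pos].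
        apply Rdiv_lt_0_compat; [lra | now apply Hsq]. }
    enough (0 < -1 * sumZ (- Z.of_nat m) (Z.of_nat m) b) by lra.
    rewrite <- sumZ_scal. apply sumZ_pos; [lia | apply Hneg; lia |].
    intros k Hk. left. now apply Hneg.
Qed.
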